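(* Let $\mathcal{H}$ be a hyperplane arrangement in general position in $\mathbb{R}^3$, let $n:=|\mathcal{H}|\ge 1$ be the number of hyperplanes, let $G$ be the chamber graph of $\mathcal{H}$, and let $\varepsilon\in(0,1)$. Then the $\varepsilon$-mixing time of the lazy simple random walk on $G$ satisfies $$t_{\mathrm{mix}}(\varepsilon)=O\!\left(n^2\log\frac{n}{\varepsilon}\right),$$ where the implied constant is absolute (independent of $\mathcal{H}$, $n$ and $\varepsilon$).
   Context: Arrangement: $\mathcal{H}$ is a finite set of affine hyperplanes in $\mathbb{R}^3$. Chambers are the connected components of the complement of the union of the hyperplanes. General position in $\mathbb{R}^3$: the intersection of any $k\le 3$ hyperplanes of $\mathcal{H}$ is an affine subspace of dimension $3-k$, and no $4$ hyperplanes have a common point. Chamber graph: vertices are the chambers; two chambers are adjacent iff they share a common facet (equivalently, are separated by exactly one hyperplane). Lazy simple random walk on $G$: at each step stay put with probability $1/2$, otherwise move to a uniformly random neighbor; its transition matrix is $P$ and its stationary distribution is $\pi(v)=\deg(v)/(2|E(G)|)$. The $\varepsilon$-mixing time is $t_{\mathrm{mix}}(\varepsilon)=\min\{t\ge 0:\max_{v\in V(G)}\|P^t(v,\cdot)-\pi\|_{\mathrm{TV}}\le\varepsilon\}$, where $\|\cdot\|_{\mathrm{TV}}$ is total variation distance. *)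

(* Defs.v *)
From mathcomp Require Import all_boot all_order all_algebra finmap.
From mathcomp Require Import all_classical all_reals all_analysis.

Set Implicit Arguments.
Unset Strict Implicit.
Unset Printing Implicit Defensive.

Import Order.TTheory GRing.Theory Num.Theory.
Import numFieldNormedType.Exports.

Local Open Scope ring_scope.

Section Arrangements.
Local Open Scope classical_set_scope.
Context {R : realType} {d : nat}.
Implicit Types (A B C D F h : set 'rV[R]_d) (H K : {fset set 'rV[R]_d}).

(* A is an affine subspace of dimension k: a translate p + (row space of U). *)
Definition affine_subspace (k : nat) A : Prop :=
  exists (p : 'rV[R]_d) (U : 'M[R]_d),
    \rank U = k /\ A = [set x | (x - p <= U)%MS].

Definition affine_hull F : set 'rV[R]_d :=
  [set x | forall k A, affine_subspace k A -> F `<=` A -> A x].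

Definition has_dim F (k : nat) : Prop := affine_subspace k (affine_hull F).

Definition arrangement H : Prop :=
  forall h, h \in H -> affine_subspace d.-1 h.

Definition general_position H : Prop :=
  forall K, (K `<=` H)%fset ->
    ((#|` K| <= d)%N ->
       affine_subspace (d - #|` K|) (\bigcap_(h in [set` K]) h)) /\
    (#|` K| = d.+1 -> \bigcap_(h in [set` K]) h = set0).

Definition arr_complement H : set 'rV[R]_d := ~` \bigcup_(h in [set` H]) h.

Definition chambers H : set (set 'rV[R]_d) :=
  [set connected_component (arr_complement H) x | x in arr_complement H].

(* The closed faces of a chamber C are the nonempty sets  closure C `&` X  with
   X an intersection of members of H; those of codimension 1 necessarily come
   from a single hyperplane. *)
Definition facet H C F : Prop :=
  has_dim F d.-1 /\ exists2 h, h \in H & F = closure C `&` h.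

(* A finite arrangement has finitely many chambers, hence fset_set does not
   take its default value here. *)
Definition chamber_type H : finType := fset_set (chambers H).

Definition chamber_adj H : rel (chamber_type H) := fun v w =>
  `[< v <> w /\ exists2 F, facet H (val v) F & facet H (val w) F >].

End Arrangements.
Arguments chamber_adj {R d} H _ _.

Section LazyWalk.
Context {R : realType} {V : finType} (e : rel V).

Definition degree (v : V) : nat := #|[set w | e v w]%SET|.

Definition edges : {set {set V}} :=
  [set E : {set V} | [exists v, exists w, e v w && (E == [set v; w]%SET)]]%SET.

Definition lazy_step (v w : V) : R :=
  2^-1 * (v == w)%:R + 2^-1 * ((e v w)%:R / (degree v)%:R).

Definition lazy_mx : 'M[R]_#|V| :=
  \matrix_(i, j) lazy_step (enum_val i) (enum_val j).

Definition walk_dist (t : nat) (v : V) : V -> R :=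
  fun w => (lazy_mx ^+ t) (enum_rank v) (enum_rank w).

Definition stationary (v : V) : R := (degree v)%:R / (2 * #|edges|)%:R.

Definition tv_dist (mu nu : V -> R) : R :=
  \big[Num.max/0]_(A : {set V}) `|\sum_(v in A) mu v - \sum_(v in A) nu v|.

Definition mixing_dist (t : nat) : R :=
  \big[Num.max/0]_(v : V) tv_dist (walk_dist t v) stationary.

Definition is_mixing_time (eps : R) (t : nat) : Prop :=
  mixing_dist t <= eps /\ forall s : nat, mixing_dist s <= eps -> (t <= s)%N.

End LazyWalk.

(* Main.v *)
Require Import Defs.
From mathcomp Require Import all_boot all_order all_algebra finmap.
From mathcomp Require Import all_classical all_reals all_analysis.
From mathcomp Require Import ring lra zify.

(** The theorem is a Poincare inequality in disguise.  If every function [f] on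
    the chambers has a constant [c] with
      sum over u of deg u (f u - c)^2
        <= C n^2 (sum over adjacent u, v of (f u - f v)^2),
    then a lazy step shrinks the squared degree-weighted norm of a centred function
    by a factor [1 - 1 / (4 C n^2)] ([step_contract], [iter_step_contract]).  The
    total degree is at most [4 n^3], so about [12 C n^2 ln (n / eps)] steps
    bring every row of the walk within [eps] of stationarity.

    A chamber is the set of points with a given vector of strict signs with
    respect to the planes ([component_cell]), and two chambers are adjacent when
    their sign vectors differ in one coordinate ([adjacentE]).  So the
    inequality is one about the sign vectors that are realized by points.

    A vertex of the arrangement is a triple [T] of planes.  Exchanging one plane
    of a triple means moving along the line that carries the two others, and
    three exchanges lead from any triple to any other one ([johnson]).  A move
    along a line passes at most [n] vertices, which by the Cauchy-Schwarz
    inequality accounts for the factor [n^2].  The difficulty is to walk along a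
    line through chambers without charging a facet once for each of its
    possibly [n] vertices.  Order the points of space lexicographically, and let
    [low T] and [high T] be the two chambers at [T] that lie above and below [T],
    that is, those of which [T] is the first and the last vertex.  A chamber has
    at most one first vertex, so the three facets of [low T] through [T] may all
    be charged to [T], and likewise for [high T]; [star_jumps T] is the variation
    of [f] across these six facets.  If [T] precedes [T'] and they are consecutive
    on a line, then [low T] and [high T'] lie along the edge from [T] to [T'] and
    can only be separated by the two planes containing it, and a similar remark
    holds for [high T] and [low T'].  Hence [f (low T)] is close to [f (high T')]
    and [f (high T)] to [f (low T')], with an error controlled by the star jumps
    of [T] and [T'] ([consec_cross]).

    It follows that [f (low T) + f (high T)] varies slowly along the lines, so
    that its variance is controlled by [johnson], whereas
    [f (low T) - f (high T)] nearly changes its sign at each step along a line.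
    Go around a triangle cut out by three lines in one of the planes.  Any other
    plane meets the boundary of the triangle in zero or two points, so the number
    of steps is odd and the difference returns to nearly its opposite: it is
    small ([triangle_ends_diff]).  Together these bound the variance of [f] on the
    chambers [low T] ([low_variance]).

    Finally every facet has a vertex once there are three planes ([face_full]).
    So the degree of a chamber is at most three times its number of vertices
    ([valence_le]), and the values of [f] at the eight chambers around [T] are
    compared inside a cube ([cube_le]).  With at most three planes the whole
    chamber graph is a cube. *)

Set Implicit Arguments.
Unset Strict Implicit.
Unset Printing Implicit Defensive.

Import Order.TTheory GRing.Theory Num.Theory.
Import numFieldNormedType.Exports.

Local Open Scope ring_scope.

(** * Sums of squares *)

Section Squares.
Variables (R : realFieldType).

Lemma eqr_le (x y : R) : x = y -> x <= y.
Proof. by move=> ->. Qed.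

Lemma sqr_le_norm (x y : R) : `|x| <= y -> x ^+ 2 <= y ^+ 2.
Proof.
move=> H; have y0 : 0 <= y by apply: le_trans H.
by rewrite -[x ^+ 2]real_normK ?num_real // ler_pXn2r ?nnegrE.
Qed.

(** This identity is the source of both the Cauchy-Schwarz inequality below and
    the expression of a variance as a mean over pairs. *)
Lemma sum_sqr_diff (B : finType) (Q : pred B) (f : B -> R) :
  \sum_(x | Q x) \sum_(y | Q y) (f x - f y) ^+ 2 =
   2 * (#|Q|%:R * \sum_(x | Q x) f x ^+ 2) - 2 * (\sum_(x | Q x) f x) ^+ 2.
Proof.
under eq_bigr => i _.
  under eq_bigr => j _ do rewrite sqrrB addrAC.
  rewrite !big_split /= sumr_const sumrN -mulr_natl.
  under [X in - X]eq_bigr => j _ do rewrite -mulr_natl mulrA.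
  rewrite -mulr_sumr; over.
rewrite !big_split /= sumrN sumr_const -mulr_sumr -mulr_suml -mulr_sumr.
by rewrite -mulr_natl expr2; ring.
Qed.

Lemma sqr_sum_le (B : finType) (Q : pred B) (f : B -> R) :
  (\sum_(i | Q i) f i) ^+ 2 <= #|Q|%:R * \sum_(i | Q i) f i ^+ 2.
Proof.
have : 0 <= \sum_(x | Q x) \sum_(y | Q y) (f x - f y) ^+ 2.
  by apply: sumr_ge0 => i _; apply: sumr_ge0 => j _; rewrite sqr_ge0.
by rewrite sum_sqr_diff; lra.
Qed.

Lemma variance_mean (B : finType) (Q : pred B) (f : B -> R) : (0 < #|Q|)%N ->
  exists c, 2 * #|Q|%:R * \sum_(x | Q x) (f x - c) ^+ 2 =
     \sum_(x | Q x) \sum_(y | Q y) (f x - f y) ^+ 2.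
Proof.
move=> Q0; have N0 : #|Q|%:R != 0 :> R by rewrite pnatr_eq0 -lt0n.
exists ((\sum_(x | Q x) f x) / #|Q|%:R); rewrite sum_sqr_diff.
set c := _ / _; have Ec : \sum_(x | Q x) f x = c * #|Q|%:R by rewrite /c divfK.
have -> : \sum_(x | Q x) (f x - c) ^+ 2 =
    \sum_(x | Q x) f x ^+ 2 - 2 * c * (\sum_(x | Q x) f x) + #|Q|%:R * c ^+ 2.
  rewrite mulr_sumr -sumrB [#|Q|%:R * _]mulr_natl -sumr_const -big_split /=.
  by apply: eq_bigr => x _; ring.
by rewrite Ec; ring.
Qed.

End Squares.

(** * Lazy random walks: from a Poincare inequality to mixing *)

Section LazyChain.
Context {R : realType} {V : finType} (e : rel V).
Hypothesis e_sym : symmetric e.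
Hypothesis e_irr : irreflexive e.
Hypothesis deg_gt0 : forall v, (0 < degree e v)%N.

Local Notation deg v := ((degree e v)%:R : R).

(** Each edge is the image of its two orientations. *)
Lemma sum_deg_edges : (\sum_v degree e v = 2 * #|edges e|)%N.
Proof.
pose D := [set x : V * V | e x.1 x.2]%SET.
have -> : (\sum_v degree e v = #|D|)%N.
  rewrite -sum1_card (eq_bigl (fun x : V * V => true && e x.1 x.2)); last first.
    by move=> x; rewrite inE.
  rewrite -(pair_big_dep predT e (fun _ _ => 1%N)) /=.
  apply: eq_bigr => v _; rewrite /degree -sum1_card.
  by apply: eq_bigl => w; rewrite inE.
rewrite -sum1_card (partition_big (fun x : V * V => [set x.1; x.2]%SET)
  (mem (edges e))) /=; last first.
  move=> [v w]; rewrite inE /= => evw; rewrite inE.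
  by apply/existsP; exists v; apply/existsP; exists w; rewrite evw eqxx.
rewrite mulnC -sum_nat_const; apply: eq_bigr => E.
rewrite inE => /existsP[v /existsP[w /andP[evw /eqP ->]]].
have nvw : v != w by apply: contraTneq evw => ->; rewrite e_irr.
rewrite (eq_bigl (mem [set (v, w); (w, v)]%SET)) ?sum1_card ?cards2.
  by rewrite xpair_eqE negb_and nvw.
move=> [x y]; rewrite !inE /= !xpair_eqE; apply/andP/orP; last first.
  case=> /andP[/eqP -> /eqP ->]; split => //; first by rewrite e_sym.
  by rewrite finset.setUC.
case=> exy /eqP Exy.
have nxy : x != y by apply: contraTneq exy => ->; rewrite e_irr.
have : x \in [set v; w]%SET by rewrite -Exy !inE eqxx.
have : y \in [set v; w]%SET by rewrite -Exy !inE eqxx orbT.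
rewrite !inE => /orP[]/eqP Ey /orP[]/eqP Ex; subst; rewrite ?eqxx in nxy *.
all: by auto.
Qed.

(** Ordered pairs are summed, so each edge counts twice. *)
Definition dirichlet (f : V -> R) := \sum_u \sum_(v | e u v) (f u - f v) ^+ 2.
Definition wnorm2 (f : V -> R) := \sum_v deg v * f v ^+ 2.
Definition step (f : V -> R) v := \sum_w lazy_step e v w * f w.

Lemma degE v : deg v = \sum_(w | e v w) 1.
Proof. by rewrite sumr_const /degree cardsE. Qed.

Lemma stepE f v : step f v = 2^-1 * (f v + (deg v)^-1 * \sum_(w | e v w) f w).
Proof.
rewrite /step /lazy_step.
under eq_bigr => w _ do rewrite mulrDl -!mulrA.
rewrite big_split /= -!mulr_sumr mulrDr; congr (_ + _).
  congr (_ * _); rewrite (bigD1 v) //= eqxx mul1r big1 ?addr0 // => i niv.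
  by rewrite eq_sym (negbTE niv) mul0r.
congr (_ * _); rewrite mulr_sumr [RHS]big_mkcond; apply: eq_bigr => w _.
by case: (e v w); rewrite ?mul1r ?mul0r.
Qed.

(** Reversibility: each vertex is summed once for each of its neighbours. *)
Lemma sum_sym (F : V -> R) :
  \sum_v \sum_(w | e v w) F w = \sum_v deg v * F v.
Proof.
rewrite (exchange_big_dep predT) //=; apply: eq_bigr => w _.
rewrite degE mulr_suml; apply: eq_big => [v|v _]; first by rewrite e_sym.
by rewrite mul1r.
Qed.

Lemma step_mean f : \sum_v deg v * step f v = \sum_v deg v * f v.
Proof.
have dN v : deg v != 0 by rewrite pnatr_eq0 -lt0n.
under eq_bigr => v _ do rewrite stepE.
transitivity (2^-1 * (\sum_v deg v * f v + \sum_v \sum_(w | e v w) f w)).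
  rewrite -big_split mulr_sumr; apply: eq_bigr => v _ /=.
  by field.
by rewrite sum_sym; field.
Qed.

Lemma dirichletE f :
  dirichlet f = 2 * (wnorm2 f - \sum_v f v * \sum_(w | e v w) f w).
Proof.
have -> : dirichlet f = wnorm2 f + \sum_v \sum_(w | e v w) f w ^+ 2
    - 2 * \sum_v f v * \sum_(w | e v w) f w.
  rewrite mulr_sumr -big_split -sumrB; apply: eq_bigr => v _ /=.
  rewrite degE mulr_suml -big_split /= mulr_sumr mulr_sumr -sumrB.
  by apply: eq_bigr => w _; ring.
by rewrite sum_sym -/(wnorm2 f); ring.
Qed.

(** Write the step as the mean of [f] and of its average [g] over neighbours.
    Convexity gives [wnorm2 g <= wnorm2 f], so the norm of the step is at most
    half of [wnorm2 f] plus half of the inner product of [f] and [g].  Laziness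
    thus replaces any spectral decomposition. *)
Lemma step_contract f : wnorm2 (step f) <= wnorm2 f - 4^-1 * dirichlet f.
Proof.
rewrite dirichletE.
have dN v : deg v != 0 by rewrite pnatr_eq0 -lt0n.
have dP v : 0 < deg v by rewrite ltr0n.
suff H : \sum_v (deg v)^-1 * (\sum_(w | e v w) f w) ^+ 2 <= wnorm2 f.
  rewrite {1}/wnorm2.
  have -> : \sum_v deg v * step f v ^+ 2 = 4^-1 * (wnorm2 f +
     2 * (\sum_v f v * \sum_(w | e v w) f w) +
     \sum_v (deg v)^-1 * (\sum_(w | e v w) f w) ^+ 2).
    rewrite mulr_sumr -!big_split mulr_sumr; apply: eq_bigr => v _ /=.
    by rewrite stepE; field.
  by lra.
rewrite /wnorm2 -sum_sym; apply: ler_sum => v _.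
rewrite ler_pdivrMl //.
apply: le_trans (sqr_sum_le _ _) _.
by rewrite /degree cardsE.
Qed.

Variable K : R.
Hypothesis K_gt0 : 0 < K.
Hypothesis poincare : forall f : V -> R, exists c : R,
  \sum_u deg u * (f u - c) ^+ 2 <= K * dirichlet f.

(** The weighted mean is the constant closest to a function. *)
Lemma centered_le f c : \sum_v deg v * f v = 0 ->
  wnorm2 f <= \sum_u deg u * (f u - c) ^+ 2.
Proof.
move=> f0.
have -> : \sum_u deg u * (f u - c) ^+ 2 =
   wnorm2 f - 2 * c * \sum_v deg v * f v + \sum_v deg v * c ^+ 2.
  rewrite mulr_sumr -sumrB -big_split; apply: eq_bigr => v _ /=; ring.
rewrite f0 mulr0 subr0 lerDl; apply: sumr_ge0 => v _.
by rewrite mulr_ge0 ?sqr_ge0 ?ler0n.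
Qed.

Lemma iter_step_mean f t : \sum_v deg v * f v = 0 ->
  \sum_v deg v * iter t step f v = 0.
Proof. by elim: t => //= t IH /IH; rewrite step_mean. Qed.

Lemma wnorm2_ge0 f : 0 <= wnorm2 f.
Proof. by apply: sumr_ge0 => v _; rewrite mulr_ge0 ?sqr_ge0 ?ler0n. Qed.

(** The constant in the Poincare inequality may depend on the iterate, since a
    centred function is closest to the constant zero. *)
Lemma iter_step_contract f t : \sum_v deg v * f v = 0 ->
  wnorm2 (iter t step f) <= expR (- (t%:R / (4 * K))) * wnorm2 f.
Proof.
move=> f0; elim: t => [|t IH] /=.
  by rewrite mul0r oppr0 expR0 mul1r.
set g := iter t step f in IH *.
have g0 : \sum_v deg v * g v = 0 by exact: iter_step_mean.
have [c gc] := poincare g.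
have H1 : wnorm2 g <= K * dirichlet g.
  by apply: le_trans gc; exact: centered_le.
have H2 := step_contract g.
have H3 : wnorm2 (step g) <= (1 - (4 * K)^-1) * wnorm2 g.
  apply: le_trans H2 _; rewrite mulrBl mul1r lerB //.
  rewrite invfM -mulrA ler_pM2l ?invr_gt0 ?ltr0n // ler_pdivrMl //.
have H4 : 1 - (4 * K)^-1 <= expR (- (4 * K)^-1).
  exact: expR_ge1Dx.
apply: le_trans H3 _; apply: (@le_trans _ _ (expR (- (4 * K)^-1) * wnorm2 g)).
  by rewrite ler_wpM2r ?wnorm2_ge0.
apply: le_trans (ler_wpM2l (expR_ge0 _) IH) _.
rewrite mulrA -expRD -opprD.
suff -> : (4 * K)^-1 + t%:R / (4 * K) = t.+1%:R / (4 * K) :> R by [].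
by rewrite -addn1 natrD; field; rewrite lt0r_neq0.
Qed.

Lemma walk_iter (A : {set V}) t v :
  \sum_(w in A) (walk_dist e t v w : R) = iter t step (fun w => (w \in A)%:R) v.
Proof.
have E : forall i, \sum_(w in A) ((lazy_mx e ^+ t : 'M[R]_#|V|) i (enum_rank w)) =
    iter t step (fun w => (w \in A)%:R) (enum_val i).
  elim: t => [|t IH] i /=.
    rewrite expr0 big_mkcond (bigD1 (enum_val i)) //= big1 ?addr0.
      by rewrite mxE enum_valK eqxx; case: (_ \in A).
    move=> w nw; case: (w \in A) => //; rewrite mxE.
    case: eqP => // Ei; move: nw; rewrite Ei enum_rankK eqxx //.
  rewrite exprS.
  under eq_bigr => w _ do rewrite mxE.
  rewrite exchange_big /= /step.
  rewrite (reindex_onto (@enum_rank V) enum_val) /=; last first.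
    by move=> j _; rewrite enum_valK.
  apply: eq_big => [w|w _]; first by rewrite enum_rankK eqxx.
  by rewrite -mulr_sumr IH enum_rankK mxE enum_rankK.
by rewrite /walk_dist E enum_rankK.
Qed.

Lemma iter_step_sub (f g : V -> R) c t v : (forall w, f w = g w - c) ->
  iter t step f v = iter t step g v - c.
Proof.
elim: t v f g => [|t IH] v f g fg //=.
rewrite !stepE (IH v f g) //.
under eq_bigr => w _ do rewrite (IH w f g) //.
rewrite sumrB sumr_const.
have -> : #|e v| = degree e v by rewrite /degree cardsE.
have dN : deg v != 0 by rewrite pnatr_eq0 -lt0n.
by rewrite -mulr_natl; field.
Qed.

Hypothesis V_inh : V.
Let M : R := \sum_v deg v.

Lemma deg_sum_gt0 : 0 < M.
Proof.
have h : deg V_inh <= M.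
  by rewrite /M (bigD1 V_inh) //= lerDl sumr_ge0 // => i _; rewrite ler0n.
by apply: lt_le_trans h; rewrite ltr0n.
Qed.

(** The walk from [v] charges [A] with the value at [v] of the iterated step
    applied to the indicator of [A].  A point value is bounded by the norm because
    degrees are at least one, and the centred indicator has squared
    norm [M q (1 - q) <= M / 4], where [q] is the stationary mass of [A]. *)
Lemma tv_dist_le (t : nat) (v : V) (A : {set V}) :
  (\sum_(w in A) (walk_dist e t v w : R) - \sum_(w in A) stationary e w) ^+ 2 <=
  expR (- (t%:R / (4 * K))) * (M / 4).
Proof.
have M0 := deg_sum_gt0; have Mn : M != 0 by rewrite gt_eqF.
set q := \sum_(w in A) stationary e w.
have qE : q * M = \sum_w deg w * (w \in A)%:R.
  rewrite /q mulr_suml big_mkcond; apply: eq_bigr => w _.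
  case: (w \in A); rewrite ?mulr0 // /stationary -sum_deg_edges natr_sum -/M.
  by rewrite mulr1 divfK.
clearbody q.
pose f w : R := (w \in A)%:R - q.
have f0 : \sum_w deg w * f w = 0.
  under eq_bigr => w _ do rewrite mulrBr.
  by rewrite sumrB -mulr_suml -/M -qE; ring.
rewrite walk_iter -(@iter_step_sub f) //.
apply: (@le_trans _ _ (wnorm2 (iter t step f))).
  rewrite /wnorm2 (bigD1 v) //=.
  have h : 1 <= deg v by rewrite ler1n.
  set z := iter t step f v; apply: (@le_trans _ _ (deg v * z ^+ 2)).
    by rewrite ler_peMl ?sqr_ge0.
  by rewrite lerDl sumr_ge0 // => i _; rewrite mulr_ge0 ?sqr_ge0 ?ler0n.
apply: le_trans (iter_step_contract _ f0) _.
rewrite ler_wpM2l ?expR_ge0 //.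
have -> : wnorm2 f = (q - q ^+ 2) * M.
  transitivity (q * M - 2 * q * (q * M) + q ^+ 2 * M); last by ring.
  rewrite qE /M !mulr_sumr -sumrB -big_split.
  by apply: eq_bigr => w _ /=; rewrite /f; case: (w \in A) => /=; ring.
rewrite mulrC ler_pM2l //.
have : 0 <= (q - 2^-1) ^+ 2 by rewrite sqr_ge0.
nra.
Qed.

Lemma mixing_dist_le (t : nat) (eps : R) : 0 < eps ->
  expR (- (t%:R / (4 * K))) * (M / 4) <= eps ^+ 2 ->
  mixing_dist e t <= eps.
Proof.
move=> eps0 H; apply: bigmax_le => [|v _]; first exact: ltW.
apply: bigmax_le => [|A _]; first exact: ltW.
rewrite -(@ler_pXn2r _ 2) ?nnegrE ?normr_ge0 ?(ltW eps0) //.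
rewrite real_normK ?num_real //. exact: le_trans (tv_dist_le t v A) H.
Qed.

End LazyChain.

(** * Lexicographic positivity and sign vectors *)

Section Lex.
Variable R : realFieldType.
Implicit Types u v : 'rV[R]_3.

Let c0 : 'I_3 := @Ordinal 3 0 isT.
Let c1 : 'I_3 := @Ordinal 3 1 isT.
Let c2 : 'I_3 := @Ordinal 3 2 isT.

(** Lexicographic positivity replaces a generic linear functional: it is never
    zero on a nonzero vector, so it orients every line of the arrangement. *)
Definition lexpos u : bool :=
  (0 < u 0 c0) || ((u 0 c0 == 0) &&
    ((0 < u 0 c1) || ((u 0 c1 == 0) && (0 < u 0 c2)))).

Lemma lexposN u : u != 0 -> lexpos (- u) = ~~ lexpos u.
Proof.
move=> u0; rewrite /lexpos !mxE !oppr_gt0 !oppr_eq0.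
have := u0; case: (ltgtP (u 0 c0) 0) => //= E0.
case: (ltgtP (u 0 c1) 0) => //= E1.
case: (ltgtP (u 0 c2) 0) => //= E2 /eqP[]; apply/rowP => i; rewrite mxE.
case: i => [[|[|[|//]]] hi].
- by rewrite -E0; congr (u _ _); apply: val_inj.
- by rewrite -E1; congr (u _ _); apply: val_inj.
- by rewrite -E2; congr (u _ _); apply: val_inj.
Qed.

Lemma lexposD u v : lexpos u -> lexpos v -> lexpos (u + v).
Proof.
rewrite /lexpos !mxE.
move: (u 0 c0) (u 0 c1) (u 0 c2) (v 0 c0) (v 0 c1) (v 0 c2) => a b c a' b' c'.
case: (ltgtP a 0) => //= Ea; case: (ltgtP a' 0) => //= Ea'; subst.
- by move=> _ _; rewrite addr_gt0.
- by move=> _ _; rewrite addr0 Ea.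
- by move=> _ _; rewrite add0r Ea'.
rewrite addr0 ltxx eqxx /=.
case: (ltgtP b 0) => //= Eb; case: (ltgtP b' 0) => //= Eb'; subst.
- by move=> _ _; rewrite addr_gt0.
- by move=> _ _; rewrite addr0 Eb.
- by move=> _ _; rewrite add0r Eb'.
by rewrite addr0 ltxx eqxx /=; apply: addr_gt0.
Qed.

Lemma lexposZ (c : R) u : 0 < c -> lexpos (c *: u) = lexpos u.
Proof.
by move=> c0'; rewrite /lexpos !mxE !pmulr_rgt0 // !mulf_eq0 gt_eqF.
Qed.

Lemma lexpos0 : lexpos 0 = false.
Proof. by rewrite /lexpos !mxE !ltxx eqxx. Qed.

Lemma lexposZneg (c : R) u : c != 0 -> u != 0 ->
  lexpos (c *: u) = (lexpos u != (c < 0)).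
Proof.
move=> c0' u0; case: ltgtP c0' => // Ec _.
  have -> : c *: u = - ((- c) *: u) by rewrite scaleNr opprK.
  rewrite lexposN ?lexposZ ?oppr_gt0 //; first by case: lexpos.
  by rewrite scaler_eq0 oppr_eq0 (negbTE u0) lt_eqF.
by rewrite lexposZ //; case: lexpos.
Qed.

Definition lexge u := (u == 0) || lexpos u.

Lemma lexge_sum (I : finType) (P : pred I) (F : I -> 'rV[R]_3) :
  (forall i, P i -> lexge (F i)) -> lexge (\sum_(i | P i) F i).
Proof.
move=> H; apply: (big_ind lexge) => //; first by rewrite /lexge eqxx.
move=> u v /orP[/eqP ->|hu]; first by rewrite add0r.
case/orP=> [/eqP ->|hv]; first by rewrite addr0 /lexge hu orbT.
by rewrite /lexge lexposD ?orbT.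
Qed.

Lemma lexge_anti u : lexge u -> lexge (- u) -> u = 0.
Proof.
case: (eqVneq u 0) => // u0; rewrite /lexge oppr_eq0 (negbTE u0) /= lexposN //.
by case: lexpos.
Qed.

End Lex.

Section Signs.
Variables (R : realFieldType) (I : finType).
Implicit Types (s t : {ffun I -> bool}) (T : {set I}).

Definition flip s m : {ffun I -> bool} := [ffun i => s i (+) (i == m)].

Lemma flipK s m : flip (flip s m) m = s.
Proof. by apply/ffunP => i; rewrite !ffunE -addbA addbb addbF. Qed.

Lemma flipC s m k : flip (flip s m) k = flip (flip s k) m.
Proof. by apply/ffunP => i; rewrite !ffunE addbAC. Qed.

Lemma flip_neq s m : flip s m != s.
Proof.
by apply/eqP => /ffunP/(_ m); rewrite ffunE eqxx addbT; case: (s m).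
Qed.

Lemma flip_inj s : injective (flip s).
Proof.
move=> m k /ffunP/(_ m); rewrite !ffunE eqxx.
by case: (s m); case: eqP.
Qed.

Variable phi : {ffun I -> bool} -> R.

Definition jump s m := `|phi s - phi (flip s m)|.

Lemma jump_ge0 s m : 0 <= jump s m.
Proof. exact: normr_ge0. Qed.

Lemma jump_flip s m : jump (flip s m) m = jump s m.
Proof. by rewrite /jump flipK distrC. Qed.

(** Two sign vectors that agree off two coordinates are corners of a common
    square, which allows four relative positions. *)
Lemma agree_off2 s t j k :
    (forall i, i != j -> i != k -> s i = t i) -> j != k ->
  [\/ t = s, t = flip s j, t = flip s k | t = flip (flip s j) k].
Proof.
move=> H jk.
have H' (u : {ffun I -> bool}) : (forall i, i != j -> i != k -> s i = u i) ->
    t j = u j -> t k = u k -> t = u.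
  move=> Hu tj tk; apply/ffunP => i.
  by case: (eqVneq i j) => [-> //|ij]; case: (eqVneq i k) => [-> //|ik];
     rewrite -H // Hu.
have kj : k != j by rewrite eq_sym.
case: (boolP (t j == s j)) => /eqP tj; case: (boolP (t k == s k)) => /eqP tk.
- by apply: Or41; apply: H'.
- apply: Or43; apply: H' => [i ij ik||]; rewrite !ffunE ?eqxx.
  + by rewrite (negbTE ik) addbF.
  + by rewrite (negbTE jk) addbF.
  + by move: tk; case: (t k); case: (s k).
- apply: Or42; apply: H' => [i ij ik||]; rewrite !ffunE ?eqxx.
  + by rewrite (negbTE ij) addbF.
  + by move: tj; case: (t j); case: (s j).
  + by rewrite (negbTE kj) addbF.
- apply: Or44; apply: H' => [i ij ik||]; rewrite !ffunE ?eqxx.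
  + by rewrite (negbTE ij) (negbTE ik) !addbF.
  + by rewrite (negbTE jk) addbF; move: tj; case: (t j); case: (s j).
  + by rewrite (negbTE kj) addbF; move: tk; case: (t k); case: (s k).
Qed.

(** In the square of coordinates [j], [k], only the four sides at the corners
    [s] and [t] are used; the path between these corners needs at most two. *)
Lemma square_near s t j k :
    (forall i, i != j -> i != k -> s i = t i) -> j != k ->
  `|phi s - phi t| <= jump s j + jump s k + jump t j + jump t k.
Proof.
move=> H jk; have := jump_ge0 s j; have := jump_ge0 s k.
have := jump_ge0 t j; have := jump_ge0 t k.
case: (agree_off2 H jk) => ->.
- by rewrite subrr normr0; lra.
- by rewrite -/(jump s j); lra.
- by rewrite -/(jump s k); lra.
rewrite jump_flip => h1 h2 h3 h4.
have := ler_distD (phi (flip s j)) (phi s) (phi (flip (flip s j) k)).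
by rewrite -/(jump s j) -/(jump (flip s j) k); lra.
Qed.

(** The corners opposite to [s] and [t] are also joined by sides at [s] or at
    [t]: when [s] and [t] are neighbours the path goes all the way round through
    both of them. *)
Lemma square_far s t j k :
    (forall i, i != j -> i != k -> s i = t i) -> j != k ->
  `|phi (flip (flip s j) k) - phi (flip (flip t j) k)|
    <= jump s j + jump s k + jump t j + jump t k.
Proof.
move=> H jk; have := jump_ge0 s j; have := jump_ge0 s k.
have := jump_ge0 t j; have := jump_ge0 t k.
case: (agree_off2 H jk) => ->.
- by rewrite subrr normr0; lra.
- rewrite flipK jump_flip => h1 h2 h3 h4.
  have t1 := ler_distD (phi (flip s j)) (phi (flip (flip s j) k)) (phi (flip s k)).
  have t2 := ler_distD (phi s) (phi (flip s j)) (phi (flip s k)).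
  rewrite -/(jump s k) in t2.
  rewrite [X in _ <= X + _]distrC -/(jump s j) in t2.
  rewrite [X in _ <= X + _]distrC -/(jump (flip s j) k) in t1.
  by lra.
- rewrite [flip (flip (flip s k) j) k]flipC flipK jump_flip [flip (flip s j) k]flipC.
  move=> h1 h2 h3 h4.
  have t1 := ler_distD (phi (flip s k)) (phi (flip (flip s k) j)) (phi (flip s j)).
  have t2 := ler_distD (phi s) (phi (flip s k)) (phi (flip s j)).
  rewrite -/(jump s j) in t2.
  rewrite [X in _ <= X + _]distrC -/(jump s k) in t2.
  rewrite [X in _ <= X + _]distrC -/(jump (flip s k) j) in t1.
  by lra.
- rewrite [flip (flip (flip s j) k) j]flipC !flipK.
  move=> h1 h2 h3 h4.
  have t1 := ler_distD (phi (flip s j)) (phi (flip (flip s j) k)) (phi s).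
  rewrite [X in _ <= X + _]distrC -/(jump (flip s j) k) in t1.
  rewrite [X in _ <= _ + X]distrC -/(jump s j) in t1.
  by rewrite -(jump_flip (flip s j) k) in t1; lra.
Qed.

End Signs.

(** * Faces and vertices of a generic arrangement of planes *)

Section Planes.
Variables (R : realFieldType) (I : finType).
Variables (a : I -> 'cV[R]_3) (b : I -> R).

Definition dot i (u : 'rV[R]_3) : R := (u *m a i) 0 0.
Definition height i (x : 'rV[R]_3) : R := dot i x - b i.
Definition neg i x := height i x < 0.

(** General position in terms of equations: up to three normals are independent,
    three of them span, and no four planes meet. *)
Definition generic_planes :=
  [/\ forall (K : {set I}) (r : I -> R), (#|K| <= 3)%N ->
        exists u, forall i, i \in K -> dot i u = r i,
      forall (K : {set I}) u, #|K| = 3 -> (forall i, i \in K -> dot i u = 0) ->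
        u = 0
    & forall (K : {set I}) x, #|K| = 4 ->
        ~ (forall i, i \in K -> height i x = 0)].

Implicit Types (s : {ffun I -> bool}) (T : {set I}) (x u : 'rV[R]_3).

(** A relatively open face: on the planes of [T], with the strict signs [s]
    off [T]. *)
Definition face s T : Prop := exists x, forall i,
  if i \in T then height i x = 0 else 0 < (-1) ^+ s i * height i x.

Lemma dotD i u v : dot i (u + v) = dot i u + dot i v.
Proof. by rewrite /dot mulmxDl mxE. Qed.

Lemma dotZ i c u : dot i (c *: u) = c * dot i u.
Proof. by rewrite /dot -scalemxAl mxE. Qed.

Lemma dotN i u : dot i (- u) = - dot i u.
Proof. by rewrite -scaleN1r dotZ mulN1r. Qed.

Lemma dot_sum i (J : finType) (P : pred J) (F : J -> 'rV[R]_3) :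
  dot i (\sum_(j | P j) F j) = \sum_(j | P j) dot i (F j).
Proof. by rewrite /dot mulmx_suml summxE. Qed.

Lemma heightD i x u : height i (x + u) = height i x + dot i u.
Proof. by rewrite /height dotD addrAC. Qed.

Lemma dotB_height i x x' : dot i (x' - x) = height i x' - height i x.
Proof. by rewrite dotD dotN /height; ring. Qed.

Lemma sign_gt0 (c : bool) (z : R) :
  (0 < (-1) ^+ c * z) = (z != 0) && ((z < 0) == c).
Proof.
by case: c; rewrite ?expr1 ?expr0 ?mulN1r ?mul1r ?oppr_gt0; case: ltgtP.
Qed.

(** Strict inequalities survive a small move. *)
Lemma small_step (P : pred I) (f g : I -> R) : (forall i, P i -> 0 < f i) ->
  exists2 c : R, 0 < c & forall i, P i -> 0 < f i + c * g i.
Proof.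
move=> f0; pose S := \sum_(i | P i) `|g i| / f i.
have S0 : 0 <= S by apply: sumr_ge0 => i Pi; rewrite divr_ge0 // ltW ?f0.
(* Moving by [(1 + S)^-1] changes each [f i] by less than itself. *)
exists (1 + S)^-1; first by rewrite invr_gt0; lra.
move=> i Pi; have fi := f0 i Pi.
have h : `|g i| / f i <= S.
  rewrite /S (bigD1 i) //= lerDl; apply: sumr_ge0 => k /andP[Pk _].
  by rewrite divr_ge0 // ltW ?f0.
have h1 : `|g i| < (1 + S) * f i.
  by rewrite -ltr_pdivrMr //; lra.
have h2 : - `|g i| <= g i by rewrite lerNl -normrN ler_norm.
have S1 : 0 < 1 + S by lra.
rewrite -(pmulr_rgt0 _ S1) mulrDr mulrA divff ?gt_eqF // mul1r.
lra.
Qed.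

Hypothesis gp : generic_planes.

Lemma face_card s T : face s T -> (#|T| <= 3)%N.
Proof.
case: gp => _ _ gpC [x Hx]; rewrite leqNgt; apply/negP => T4.
have := cards_draws T 4.
have : (0 < 'C(#|T|, 4))%N by rewrite bin_gt0.
move=> h E; rewrite -E in h; case/card_gt0P: h => K.
rewrite inE => /andP[/fintype.subsetP KT /eqP K4]; apply: (gpC K x K4) => i iK.
by have := Hx i; rewrite KT.
Qed.

(** At a point of the face, the independence of the at most three normals of [T]
    provides a direction that moves off each plane of [T] to the prescribed side. *)
Lemma face_perturb s (t : {ffun I -> bool}) T : face s T -> (forall i, i \notin T -> t i = s i) ->
  face t finset.set0.
Proof.
move=> fT st; have T3 := face_card fT; case: fT => x Hx.
case: gp => gpA _ _; have [u Hu] := gpA T (fun i => (-1) ^+ t i) T3.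
have [|c c0 Hc] := @small_step (fun i => i \notin T)
    (fun i => (-1) ^+ s i * height i x) (fun i => (-1) ^+ s i * dot i u).
  by move=> i iT; have := Hx i; rewrite (negbTE iT).
exists (x + c *: u) => i; rewrite inE heightD dotZ.
case: (boolP (i \in T)) => iT; last first.
  by rewrite st // mulrDr mulrCA; apply: Hc.
have := Hx i; rewrite iT => ->; rewrite add0r Hu // mulrCA -expr2 sqrr_sign.
by rewrite mulr1.
Qed.

(** The segment joining two points in adjacent cells crosses the plane that
    separates them, and no other one. *)
Lemma face_mid s m : face s finset.set0 -> face (flip s m) finset.set0 -> face s [set m].
Proof.
case=> x Hx [x' Hx'].
have {}Hx i : 0 < (-1) ^+ s i * height i x by have := Hx i; rewrite inE.
have {}Hx' i : 0 < (-1) ^+ (flip s m) i * height i x'.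
  by have := Hx' i; rewrite inE.
pose p := (-1) ^+ s m * height m x; pose q := - ((-1) ^+ s m * height m x').
have p0 : 0 < p by apply: Hx.
have q0 : 0 < q.
  by have := Hx' m; rewrite ffunE eqxx addbT signrN mulNr.
have pq0 : 0 < p + q by rewrite addr_gt0.
have hE i : height i ((q / (p + q)) *: x + (p / (p + q)) *: x') =
     (q * height i x + p * height i x') / (p + q).
  rewrite /height dotD !dotZ; field; exact: lt0r_neq0.
exists ((q / (p + q)) *: x + (p / (p + q)) *: x') => i.
rewrite hE inE; case: eqP => [->|im].
  by rewrite /p /q; apply/eqP; rewrite mulf_eq0; apply/orP; left; apply/eqP; ring.
rewrite mulrA divr_gt0 // mulrDr mulrCA [X in _ + X]mulrCA.
have := Hx' i; rewrite ffunE; have /eqP/negbTE -> := im; rewrite addbF => h.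
by rewrite addr_gt0 // mulr_gt0.
Qed.

(** Ratio test: move inside the planes of [T] towards some further plane, and
    stop at the first plane that is hit. *)
Lemma face_extend s T : face s T -> (#|T| < minn 3 #|I|)%N ->
  exists2 T' : {set I}, T \proper T' & face s T'.
Proof.
case=> x Hx; rewrite leq_min => /andP[T3 TI].
have [j jT] : exists j, j \notin T.
  apply/existsP; apply: contraTT TI => /existsPn H; rewrite -leqNgt.
  apply: subset_leq_card; apply/fintype.subsetP => i _.
  by have := H i; rewrite negbK.
case: gp => gpA _ _.
have [|u Hu] := gpA (j |: T) (fun i => - (-1) ^+ s j *+ (i == j)).
  by rewrite cardsU1 jT.
pose f i := (-1) ^+ s i * height i x; pose g i := - ((-1) ^+ s i * dot i u).
pose J i := (i \notin T) && (0 < g i).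
have Jj : J j.
  rewrite /J jT /= /g Hu ?setU11 // eqxx mulr1n mulrN opprK -expr2.
  by rewrite sqrr_sign ltr01.
(* [J] collects the planes that the motion approaches; [f i / g i] is the time
   at which plane [i] is reached. *)
have [k Jk Hk] := Order.TotalTheory.arg_minP (fun i => f i / g i) Jj.
set c := f k / g k in Hk.
have f0 i : i \notin T -> 0 < f i.
  by move=> iT; have := Hx i; rewrite (negbTE iT).
have c0 : 0 < c by case/andP: Jk => kT gk; rewrite divr_gt0 ?f0.
have hN i : i \notin T -> 0 <= (-1) ^+ s i * height i (x + c *: u).
  move=> iT; rewrite heightD dotZ mulrDr mulrCA -/(f i).
  have -> : (-1) ^+ s i * dot i u = - g i by rewrite opprK.
  rewrite mulrN subr_ge0; case: (ltP 0 (g i)) => gi.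
    by rewrite -ler_pdivlMr // Hk // /J iT.
  by apply: le_trans (ltW (f0 i iT)); rewrite mulr_ge0_le0 // ltW.
have h0 i : i \in T -> height i (x + c *: u) = 0.
  move=> iT; rewrite heightD dotZ Hu ?inE ?iT ?orbT //.
  have -> : (i == j) = false by apply: contraNF jT => /eqP <-.
  by have := Hx i; rewrite iT => ->; rewrite mulr0n mulr0 addr0.
have hk : height k (x + c *: u) = 0.
  have /eqP : (-1) ^+ s k * height k (x + c *: u) = 0.
    rewrite heightD dotZ mulrDr mulrCA -/(f k).
    have -> : (-1) ^+ s k * dot k u = - g k by rewrite opprK.
    case/andP: Jk => kT gk; rewrite /c mulrN divfK ?subrr //.
    by rewrite gt_eqF.
  by rewrite mulf_eq0 signr_eq0 => /eqP.
exists [set i | height i (x + c *: u) == 0]%SET.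
  apply/properP; split; last first.
    by exists k; [rewrite inE hk | case/andP: Jk].
  by apply/fintype.subsetP => i iT; rewrite inE h0.
exists (x + c *: u) => i; rewrite inE; case: eqP => // /eqP hi.
rewrite lt0r mulf_neq0 ?signr_eq0 //= hN //.
by apply: contraNN hi => iT; rewrite h0.
Qed.

(** In particular each facet of a cell has a vertex as soon as there are three
    planes. *)
Lemma face_full s T : face s T ->
  exists T' : {set I}, [/\ T \subset T', face s T' & #|T'| = minn 3 #|I|].
Proof.
move=> fT; move Ek: (minn 3 #|I| - #|T|)%N => k.
elim/ltn_ind: k T Ek fT => k IH T Ek fT.
case: (ltnP #|T| (minn 3 #|I|)) => hT; last first.
  exists T; split => //; apply/eqP; rewrite eqn_leq hT andbT leq_min.
  by rewrite (face_card fT) max_card.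
have [T1 TT1 fT1] := face_extend fT hT.
have c1 := proper_card TT1.
have [|T' [T1T' fT' cT']] := IH (minn 3 #|I| - #|T1|)%N _ T1 erefl fT1.
  by rewrite -Ek; lia.
exists T'; split => //; exact: fintype.subset_trans (proper_sub TT1) T1T'.
Qed.

Definition vertex T : 'rV[R]_3 :=
  xget 0 [set x | forall i, i \in T -> height i x = 0]%classic.

(** For three planes, the dual basis of the normals: [edge_dir T t] spans the
    line carried by the two planes of [T] other than [t]. *)
Definition edge_dir T t : 'rV[R]_3 :=
  xget 0 [set u | forall i, i \in T -> dot i u = (i == t)%:R]%classic.

Lemma height_vertex T i : (#|T| <= 3)%N -> i \in T -> height i (vertex T) = 0.
Proof.
move=> T3; apply: (@xgetPex _ 0 [set x | forall i, i \in T -> height i x = 0]%classic).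
case: gp => gpA _ _; have [u Hu] := gpA T b T3.
by exists u => k kT; rewrite /height Hu // subrr.
Qed.

Lemma dot_edge_dir T t i : (#|T| <= 3)%N -> i \in T ->
  dot i (edge_dir T t) = (i == t)%:R.
Proof.
move=> T3; apply: (@xgetPex _ 0
  [set u | forall i, i \in T -> dot i u = (i == t)%:R]%classic).
by case: gp => gpA _ _; have [u Hu] := gpA T (fun i => (i == t)%:R) T3; exists u.
Qed.

Lemma edge_dir_neq0 T t : #|T| = 3 -> t \in T -> edge_dir T t != 0.
Proof.
move=> T3 tT; apply/eqP => E; have := @dot_edge_dir T t t.
rewrite T3 E eqxx /dot mul0mx mxE => /(_ isT tT) /eqP.
by rewrite eq_sym oner_eq0.
Qed.

Lemma height_vertex_neq0 T i : #|T| = 3 -> i \notin T -> height i (vertex T) != 0.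
Proof.
move=> T3 iT; apply/eqP => E; case: gp => _ _ gpC.
apply: (gpC (i |: T) (vertex T)); first by rewrite cardsU1 iT T3.
by move=> k /setU1P[->//|kT]; rewrite height_vertex ?T3.
Qed.

Lemma vertex_expand T x : #|T| = 3 ->
  x - vertex T = \sum_(t in T) height t x *: edge_dir T t.
Proof.
move=> T3; apply/eqP; rewrite -subr_eq0; apply/eqP.
case: gp => _ gpB _; apply: (gpB T _ T3) => i iT.
rewrite dotD dotN dotB_height height_vertex ?T3 // subr0 dot_sum (bigD1 i) //=.
rewrite dotZ dot_edge_dir ?T3 // eqxx mulr1 big1 ?addr0 ?subrr // => t /andP[_ ti].
by rewrite dotZ dot_edge_dir ?T3 // eq_sym (negbTE ti) mulr0.
Qed.

Lemma vertex_inj T (T' : {set I}) : #|T| = 3 -> #|T'| = 3 -> vertex T = vertex T' -> T = T'.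
Proof.
move=> T3 T'3 E; apply/eqP; rewrite eqEcard T3 T'3 leqnn andbT.
apply/fintype.subsetP => i iT; apply: contraT => iT'.
by have := height_vertex_neq0 T'3 iT'; rewrite -E height_vertex ?T3 ?eqxx.
Qed.

(** The sign vectors of the cells that have [vertex T] in their closure. *)
Definition at_vertex T s := [forall i, (i \notin T) ==> (s i == neg i (vertex T))].

Lemma at_vertexP T s :
  reflect (forall i, i \notin T -> s i = neg i (vertex T)) (at_vertex T s).
Proof.
apply: (iffP forallP) => H i; first by move=> iT; have := H i; rewrite iT => /eqP.
by apply/implyP => iT; rewrite H.
Qed.

Lemma at_vertex_face T s : #|T| = 3 -> at_vertex T s -> face s T.
Proof.
move=> T3 /at_vertexP H; exists (vertex T) => i.
case: (boolP (i \in T)) => iT; first by rewrite height_vertex ?T3.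
by rewrite sign_gt0 H // /neg eqxx height_vertex_neq0.
Qed.

Lemma face_at_vertex T s : #|T| = 3 -> face s T -> at_vertex T s.
Proof.
move=> T3 [x Hx]; have xE : x = vertex T.
  apply/eqP; rewrite -subr_eq0; apply/eqP.
  case: gp => _ gpB _; apply: (gpB T _ T3) => i iT.
  by rewrite dotB_height height_vertex ?T3 //; have := Hx i; rewrite iT => ->; rewrite subrr.
apply/at_vertexP => i iT; have := Hx i; rewrite (negbTE iT) sign_gt0 xE.
by case/andP => _ /eqP.
Qed.

Lemma at_vertex_realized T s : #|T| = 3 -> at_vertex T s -> face s finset.set0.
Proof.
by move=> T3 /(at_vertex_face T3) fs; apply: face_perturb fs _.
Qed.

Lemma at_vertex_flip T s t : t \in T -> at_vertex T (flip s t) = at_vertex T s.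
Proof.
move=> tT; apply/at_vertexP/at_vertexP => H i iT; rewrite -H // ffunE.
all: have -> : (i == t) = false by apply: contraNF iT => /eqP ->.
all: by rewrite addbF.
Qed.

Lemma card_at_vertex T : (#|[set s | at_vertex T s]%SET| <= 2 ^ #|T|)%N.
Proof.
rewrite -card_powerset.
pose f s := [set i in T | s i]%SET.
rewrite -(@card_in_imset _ _ f).
  apply: subset_leq_card; apply/fintype.subsetP => K /imsetP[s _ ->].
  by rewrite inE; apply/fintype.subsetP => i; rewrite inE => /andP[].
move=> s t; rewrite !inE => /at_vertexP Hs /at_vertexP Ht /setP fst.
apply/ffunP => i; case: (boolP (i \in T)) => iT; last by rewrite Hs ?Ht.
by have := fst i; rewrite !inE iT.
Qed.

(** [low T] lies on the upward side of [vertex T] along the three lines through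
    it, so [vertex T] is the lexicographically first point of its closure; [high T]
    is the opposite chamber at the same vertex. *)
Definition low T : {ffun I -> bool} :=
  [ffun i => if i \in T then ~~ lexpos (edge_dir T i) else neg i (vertex T)].
Definition high T : {ffun I -> bool} :=
  [ffun i => if i \in T then lexpos (edge_dir T i) else neg i (vertex T)].

Lemma low_at T : at_vertex T (low T).
Proof. by apply/at_vertexP => i iT; rewrite ffunE (negbTE iT). Qed.

Lemma high_at T : at_vertex T (high T).
Proof. by apply/at_vertexP => i iT; rewrite ffunE (negbTE iT). Qed.

(** Since [vertex T'] lies in the closure of [low T'], which is [low T], it lies in
    the cone spanned at [vertex T] by lexicographically positive vectors. *)
Lemma low_lexge T (T' : {set I}) : #|T| = 3 -> #|T'| = 3 -> low T = low T' ->
  lexge (vertex T' - vertex T).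
Proof.
move=> T3 T'3 E; rewrite (vertex_expand _ T3); apply: lexge_sum => t tT.
case: (boolP (t \in T')) => tT'.
  by rewrite height_vertex ?T'3 // scale0r /lexge eqxx.
move/ffunP/(_ t): E; rewrite !ffunE tT (negbTE tT') => E.
rewrite /lexge lexposZneg ?edge_dir_neq0 ?height_vertex_neq0 // -/(neg t (vertex T')) -E.
by rewrite orbC; case: lexpos.
Qed.

Lemma high_lexge T (T' : {set I}) : #|T| = 3 -> #|T'| = 3 -> high T = high T' ->
  lexge (vertex T - vertex T').
Proof.
move=> T3 T'3 E; rewrite -opprB (vertex_expand _ T3) -sumrN; apply: lexge_sum => t tT.
case: (boolP (t \in T')) => tT'.
  by rewrite height_vertex ?T'3 // scale0r oppr0 /lexge eqxx.
move/ffunP/(_ t): E; rewrite !ffunE tT (negbTE tT') => E.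
have h1 := edge_dir_neq0 T3 tT; have h2 := height_vertex_neq0 T'3 tT'.
have h3 : height t (vertex T') *: edge_dir T t != 0.
  by rewrite scaler_eq0 (negbTE h1) (negbTE h2).
by rewrite /lexge lexposN // lexposZneg // -/(neg t (vertex T')) -E orbC; case: lexpos.
Qed.

(** A cell has at most one first vertex. *)
Lemma low_inj T (T' : {set I}) : #|T| = 3 -> #|T'| = 3 -> low T = low T' -> T = T'.
Proof.
move=> T3 T'3 E; apply: vertex_inj => //; apply/eqP; rewrite -subr_eq0; apply/eqP.
by apply: lexge_anti; rewrite ?opprB low_lexge.
Qed.

Lemma high_inj T (T' : {set I}) : #|T| = 3 -> #|T'| = 3 -> high T = high T' -> T = T'.
Proof.
move=> T3 T'3 E; apply: vertex_inj => //; apply/eqP; rewrite -subr_eq0; apply/eqP.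
by apply: lexge_anti; rewrite ?opprB high_lexge.
Qed.

End Planes.

(** * Walking along the lines of the arrangement *)

Section Chain.
Variables (R : realFieldType) (I : finType) (X : {set I}) (lt : rel I).
Hypothesis lt_irr : irreflexive lt.
Hypothesis lt_trans : transitive lt.
Hypothesis lt_total : forall l m, l \in X -> m \in X -> l != m -> lt l m || lt m l.

Definition between m m' := [set l in X | lt m l && lt l m']%SET.

(** Telescoping along a finite chain, for a function that is nearly multiplied by
    [eps] at each step.  Splitting at an arbitrary intermediate point avoids an
    enumeration of the chain. *)
Lemma chain_telescope (g slack : I -> R) (eps : R) :
    `|eps| = 1 -> (forall l, 0 <= slack l) ->
    (forall l l', l \in X -> l' \in X -> lt l l' -> between l l' = finset.set0 ->
       `|g l - eps * g l'| <= slack l + slack l') ->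
  forall m m', m \in X -> m' \in X -> lt m m' ->
    `|g m - eps ^+ #|between m m'|.+1 * g m'| <= 2 * \sum_(l in X) slack l.
Proof.
move=> eps1 err0 H m m' mX m'X mm'.
(* Each interior point is an end of two steps, the two extremities of one. *)
suff S : `|g m - eps ^+ #|between m m'|.+1 * g m'| <=
    2 * \sum_(l in between m m') slack l + slack m + slack m'.
  apply: le_trans S _.
  have nm : m' != m by apply: contraTneq mm' => ->; rewrite lt_irr.
  rewrite [X in _ <= _ * X](bigD1 m) //= [X in _ <= _ * (_ + X)](bigD1 m') /= ?m'X //.
  have : \sum_(l in between m m') slack l <=
      \sum_(i | (i \in X) && (i != m) && (i != m')) slack i.
    rewrite [leRHS]big_mkcond [leLHS]big_mkcond; apply: ler_sum => l _.
    rewrite inE; case: (l \in X) => //=.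
    case: (eqVneq l m) => [->|_]; first by rewrite lt_irr.
    case: (eqVneq l m') => [->|_]; first by rewrite lt_irr andbF.
    by case: (lt m l && lt l m') => /=.
  by have := err0 m; have := err0 m'; lra.
move Ek: #|between m m'| => k.
elim/ltn_ind: k m m' mX m'X mm' Ek => k IH m m' mX m'X mm' Ek.
have [E|[i]] := set_0Vmem (between m m').
  move: Ek; rewrite E cards0 => <-; rewrite expr1 big_set0 mulr0 add0r.
  exact: H.
rewrite inE => /and3P[iX mi im'].
have E : between m m' = i |: (between m i :|: between i m')%SET.
  apply/setP => l; rewrite !inE; case: (eqVneq l i) => [->|li] /=.
    by rewrite iX mi im'.
  case: (boolP (l \in X)) => //= lX.
  apply/andP/orP => [[ml lm']|].
    by case/orP: (lt_total lX iX li) => h; [left | right]; apply/andP.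
  case=> /andP[h1 h2]; split => //; first exact: lt_trans im'.
  exact: lt_trans h1.
have D : [disjoint between m i & between i m'].
  rewrite -setI_eq0; apply/eqP/setP => l; rewrite !inE.
  apply: contraFF (lt_irr i) => /andP[/and3P[_ _ li] /and3P[_ il _]].
  exact: lt_trans li.
have iN : i \notin (between m i :|: between i m')%SET.
  by rewrite !inE !lt_irr !andbF.
have cE : (k = (#|between m i| + #|between i m'|).+1)%N.
  by rewrite -Ek E cardsU1 iN add1n cardsU disjoint_setI0 // cards0 subn0.
have I1 := IH #|between m i| _ m i mX iX mi erefl.
have I2 := IH #|between i m'| _ i m' iX m'X im' erefl.
have {}I1 := I1 ltac:(by rewrite cE ltnS leq_addr).
have {}I2 := I2 ltac:(by rewrite cE ltnS leq_addl).
rewrite E big_setU1 //=.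
have -> : \sum_(l in (between m i :|: between i m')%SET) slack l =
    \sum_(l in between m i) slack l + \sum_(l in between i m') slack l.
  by rewrite -bigU //=; apply: eq_bigl => l; rewrite !inE.
have T := ler_distD (eps ^+ #|between m i|.+1 * g i) (g m)
   (eps ^+ k.+1 * g m').
have E2 : `|eps ^+ #|between m i|.+1 * g i - eps ^+ k.+1 * g m'| =
    `|g i - eps ^+ #|between i m'|.+1 * g m'|.
  have -> : k.+1 = (#|between m i|.+1 + #|between i m'|.+1)%N by rewrite cE addSn addnS.
  by rewrite exprD -mulrA -mulrBr normrM normrX eps1 expr1n mul1r.
rewrite E2 in T; apply: le_trans T _; apply: le_trans (lerD I1 I2) _.
apply: eqr_le; ring.
Qed.

End Chain.

Section Lines.
Variables (R : realFieldType) (I : finType).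
Variables (a : I -> 'cV[R]_3) (b : I -> R).
Hypothesis gp : generic_planes a b.

Local Notation vertex := (vertex a b).
Local Notation edge_dir := (edge_dir a).
Local Notation neg := (neg a b).
Local Notation height := (height a b).
Local Notation low := (low a b).
Local Notation high := (high a b).

Section OneLine.
Variable L : {set I}.
Hypothesis L2 : #|L| = 2.
Implicit Types l m : I.

(** The order of the vertices of the line [L], each of which is named by its
    third plane. *)
Definition before l m := lexpos (vertex (m |: L) - vertex (l |: L)).

Lemma card_on_line l : l \in ~: L -> #|l |: L| = 3.
Proof. by rewrite inE => lL; rewrite cardsU1 lL L2. Qed.

Lemma before_irr : irreflexive before.
Proof. by move=> l; rewrite /before subrr lexpos0. Qed.

Lemma before_trans : transitive before.
Proof.
move=> l k m kl lm; rewrite /before.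
have -> : vertex (m |: L) - vertex (k |: L) =
   (vertex (m |: L) - vertex (l |: L)) + (vertex (l |: L) - vertex (k |: L)).
  by rewrite addrA subrK.
exact: lexposD.
Qed.

Lemma on_line_notin l m : l \in ~: L -> l != m -> l \notin m |: L.
Proof. by rewrite !inE => lL lm; rewrite negb_or lm. Qed.

Lemma line_step l m : l \in ~: L -> m \in ~: L ->
  vertex (m |: L) - vertex (l |: L) = height l (vertex (m |: L)) *: edge_dir (l |: L) l.
Proof.
move=> lL mL; have cl := card_on_line lL; have cm := card_on_line mL.
rewrite (vertex_expand gp _ cl) (bigD1 l) ?setU11 //= big1 ?addr0 // => t /andP[].
rewrite !inE => /orP[->//|tL] _.
by rewrite (height_vertex gp) ?cm ?scale0r // !inE tL orbT.
Qed.

(** The position of two vertices of a line can be read off on which side of the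
    plane through one of them the other one lies, either way. *)
Lemma before_l l m : l \in ~: L -> m \in ~: L -> l != m ->
  before l m = (neg l (vertex (m |: L)) == ~~ lexpos (edge_dir (l |: L) l)).
Proof.
move=> lL mL lm; rewrite /before line_step // lexposZneg.
- by rewrite -/(neg l (vertex (m |: L))); case: lexpos; case: neg.
- by rewrite (height_vertex_neq0 gp) ?card_on_line // on_line_notin.
- by rewrite (edge_dir_neq0 gp) ?card_on_line ?setU11.
Qed.

Lemma before_total l m : l \in ~: L -> m \in ~: L -> l != m ->
  before m l = ~~ before l m.
Proof.
move=> lL mL lm; rewrite /before -opprB lexposN // line_step //.
rewrite scaler_eq0 negb_or (height_vertex_neq0 gp) ?card_on_line ?on_line_notin //.
by rewrite (edge_dir_neq0 gp) ?card_on_line ?setU11.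
Qed.

Lemma before_r l m : l \in ~: L -> m \in ~: L -> l != m ->
  before l m = (neg m (vertex (l |: L)) == lexpos (edge_dir (m |: L) m)).
Proof.
move=> lL mL lm; rewrite before_total 1?eq_sym // before_l // 1?eq_sym //.
by case: lexpos; case: neg.
Qed.

Local Notation btw := (between (~: L) before).

(** Along a line the height over a plane is affine, so it changes its sign only at
    the vertex where the plane meets the line. *)
Lemma mem_between m m' l : m \in ~: L -> m' \in ~: L -> before m m' ->
    l \in ~: L -> l != m -> l != m' ->
  (l \in btw m m') = neg l (vertex (m |: L)) (+) neg l (vertex (m' |: L)).
Proof.
move=> mL m'L mm' lL lm lm'; rewrite inE lL /=.
have H : before m l || before l m'.
  case: (boolP (before l m')) => h; first by rewrite orbT.
  rewrite -before_total // in h.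
  by rewrite (before_trans mm' h).
move: H; rewrite before_r // 1?eq_sym // before_l //.
by case: lexpos; case: neg; case: neg.
Qed.

Section Consecutive.
Variables m m' : I.
Hypotheses (mL : m \in ~: L) (m'L : m' \in ~: L).
Hypotheses (mm' : before m m') (none : btw m m' = finset.set0).

(** The cell just above the lower vertex and the one just below the upper vertex
    both follow the edge that joins consecutive vertices. *)
Lemma consec_low_high i : i \notin L -> low (m |: L) i = high (m' |: L) i.
Proof.
move=> iL; have iL' : i \in ~: L by rewrite inE.
have nm : m != m' by apply: contraTneq mm' => ->; rewrite before_irr.
rewrite !ffunE !inE (negbTE iL) !orbF.
case: (eqVneq i m) => [E|im]; case: (eqVneq i m') => [E'|im'].
- by move: nm; rewrite -E E' eqxx.
- by rewrite E; move: mm'; rewrite before_l // => /eqP.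
- by rewrite E'; move: mm'; rewrite before_r // => /eqP.
by have := mem_between mL m'L mm' iL' im im'; rewrite none inE; case: neg; case: neg.
Qed.

End Consecutive.
End OneLine.

Variable phi : {ffun I -> bool} -> R.
Local Notation jump := (jump phi).

(** The variation of [phi] across the six facets that are charged to [T]. *)
Definition star_jumps (T : {set I}) := \sum_(t in T) (jump (low T) t + jump (high T) t).

Lemma star_jumps_ge0 T : 0 <= star_jumps T.
Proof. by apply: sumr_ge0 => t _; rewrite addr_ge0 // jump_ge0. Qed.

Definition ends_sum T := phi (low T) + phi (high T).
Definition ends_diff T := phi (low T) - phi (high T).

Lemma off_pair (j k l : I) :
  uniq [:: j; k; l] = (j != k) && (l \in ~: [set j; k]%SET).
Proof.
rewrite /= !inE !negb_or ![l == _]eq_sym.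
by case: (j == k); case: (j == l); case: (k == l).
Qed.

(** [low] and [high] are antipodal at a vertex, so crossing one plane of the triple
    from one of them is the same as crossing the other two from the other one. *)
Lemma flip3 (j k l : I) : uniq [:: j; k; l] ->
  flip (high (l |: [set j; k]%SET)) l = flip (flip (low (l |: [set j; k]%SET)) j) k.
Proof.
rewrite /= !inE negb_or andbT => /andP[/andP[jk jl] kl].
apply/ffunP => i; rewrite !ffunE !inE.
case: (eqVneq i l) => [->|il] /=.
  rewrite ![l == _]eq_sym (negbTE jl) (negbTE kl).
  by case: (lexpos (edge_dir _ _)).
case: (eqVneq i j) => [->|ij] /=; first by rewrite (negbTE jk); case: (lexpos (edge_dir _ _)).
by case: (i == k); rewrite ?addbF ?addbT ?negbK.
Qed.

Lemma flip3' (j k l : I) : uniq [:: j; k; l] ->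
  flip (low (l |: [set j; k]%SET)) l = flip (flip (high (l |: [set j; k]%SET)) j) k.
Proof.
move=> U; apply: (can_inj (fun s => flipK s l)); rewrite flipK.
set h := high _; set lo := low _.
rewrite (flipC (flip h j) k l) (flipC h j l) flip3 // -/lo.
by rewrite (flipC (flip lo j) k j) !flipK.
Qed.

Lemma star_jumps3 (j k l : I) : uniq [:: j; k; l] ->
  star_jumps (l |: [set j; k]%SET) =
    let T := (l |: [set j; k])%SET in
    (jump (low T) l + jump (high T) l) + ((jump (low T) j + jump (high T) j) +
    (jump (low T) k + jump (high T) k)).
Proof.
rewrite /= !inE negb_or andbT => /andP[/andP[jk jl] kl].
rewrite /star_jumps big_setU1 /=; last by rewrite !inE negb_or ![l == _]eq_sym jl.
by rewrite big_setU1 /= ?inE // big_set1.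
Qed.

Section ConsecutiveJump.
Variables j k m m' : I.
Hypothesis jk : j != k.
Let L := [set j; k]%SET.
Hypotheses (mL : m \in ~: L) (m'L : m' \in ~: L).
Hypotheses (mm' : before L m m').
Hypotheses (none : between (~: L) (before L) m m' = finset.set0).

Let L2 : #|L| = 2. Proof. by rewrite cards2 jk. Qed.
Let um : uniq [:: j; k; m].
Proof. by rewrite off_pair jk mL. Qed.
Let um' : uniq [:: j; k; m'].
Proof. by rewrite off_pair jk m'L. Qed.
Let agree i : i != j -> i != k -> low (m |: L) i = high (m' |: L) i.
Proof.
by move=> ij ik; apply: consec_low_high => //; rewrite !inE negb_or ij.
Qed.

(** [square_near] compares [low] at [m] with [high] at [m'].  For the other pair,
    first cross the third plane at each end; by [flip3] this leads to the corners
    that [square_far] compares. *)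
Lemma consec_cross :
  `|phi (low (m |: L)) - phi (high (m' |: L))| +
  `|phi (high (m |: L)) - phi (low (m' |: L))| <=
  2 * star_jumps (m |: L) + 2 * star_jumps (m' |: L).
Proof.
have := square_near phi agree jk; have := square_far phi agree jk.
rewrite -(flip3 um) -(flip3' um') (star_jumps3 um) (star_jumps3 um') /= -/L.
set T := m |: L; set T' := m' |: L => h1 h2.
have t1 := ler_distD (phi (flip (high T) m)) (phi (high T)) (phi (low T')).
have t2 := ler_distD (phi (flip (low T') m')) (phi (flip (high T) m)) (phi (low T')).
rewrite -/(jump (high T) m) in t1.
rewrite [X in _ <= _ + X]distrC -/(jump (low T') m') in t2.
have := jump_ge0 phi (low T) m; have := jump_ge0 phi (high T') m'.
have := jump_ge0 phi (high T) j; have := jump_ge0 phi (high T) k.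
have := jump_ge0 phi (low T') j; have := jump_ge0 phi (low T') k.
have := jump_ge0 phi (low T) j; have := jump_ge0 phi (low T) k.
have := jump_ge0 phi (high T') j; have := jump_ge0 phi (high T') k.
have := jump_ge0 phi (high T) m; have := jump_ge0 phi (low T') m'.
lra.
Qed.

Lemma consec_ends_sum : `|ends_sum (m |: L) - 1 * ends_sum (m' |: L)| <=
  2 * star_jumps (m |: L) + 2 * star_jumps (m' |: L).
Proof.
apply: le_trans consec_cross; rewrite mul1r /ends_sum.
apply: le_trans (ler_normD _ _).
by apply: eqr_le; congr `|_|; ring.
Qed.

Lemma consec_ends_diff : `|ends_diff (m |: L) - (-1) * ends_diff (m' |: L)| <=
  2 * star_jumps (m |: L) + 2 * star_jumps (m' |: L).
Proof.
apply: le_trans consec_cross; rewrite /ends_diff.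
apply: le_trans (ler_normB _ _).
by apply: eqr_le; congr `|_|; ring.
Qed.

End ConsecutiveJump.

Definition line_jumps (j k : I) := \sum_(l in ~: [set j; k]%SET) star_jumps (l |: [set j; k]%SET).

Lemma line_ends_sum (j k m m' : I) : uniq [:: j; k; m] -> uniq [:: j; k; m'] ->
  `|ends_sum (m |: [set j; k]%SET) - ends_sum (m' |: [set j; k]%SET)| <= 4 * line_jumps j k.
Proof.
move=> um um'; set L := [set j; k]%SET.
move: um um'; rewrite !off_pair => /andP[jk mL] /andP[_ m'L].
have L2 : #|L| = 2 by rewrite cards2 jk.
have S : forall m m', m \in ~: L -> m' \in ~: L -> before L m m' ->
    `|ends_sum (m |: L) - ends_sum (m' |: L)| <= 4 * line_jumps j k.
  move=> {mL m'L} {}m {}m' mL m'L mm'.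
  have := @chain_telescope _ _ (~: L) (before L) (before_irr L) (@before_trans L) _
    (fun l => ends_sum (l |: L)) (fun l => 2 * star_jumps (l |: L)) 1 (normr1 _) _ _
     m m' mL m'L mm'.
  rewrite expr1n mul1r -mulr_sumr mulrA -natrM -/(line_jumps j k).
  apply.
  - by move=> l l' lL l'L ll'; rewrite (before_total L2 lL l'L ll') orbN.
  - by move=> l; rewrite mulr_ge0 // star_jumps_ge0.
  - by move=> l l' lL l'L ll' none; apply: consec_ends_sum.
case: (eqVneq m m') => [<-|nm].
  rewrite subrr normr0 mulr_ge0 // sumr_ge0 // => l _; exact: star_jumps_ge0.
have := before_total L2 mL m'L nm.
case: (boolP (before L m m')) => h; first by move=> _; exact: S.
by move=> /= h'; rewrite distrC; apply: S.
Qed.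

(** The difference changes its sign at each step, and the vertices passed on the
    way are counted by the planes that separate the two ends. *)
Lemma line_ends_diff (j k m m' : I) : uniq [:: j; k; m; m'] ->
  let L := [set j; k]%SET in
  `|ends_diff (m |: L) + \prod_(i | i \notin [:: j; k; m; m'])
       ((-1) ^+ neg i (vertex (m |: L)) * (-1) ^+ neg i (vertex (m' |: L)))
       * ends_diff (m' |: L)| <= 4 * line_jumps j k.
Proof.
move=> um /=; set L := [set j; k]%SET.
have [jk mL m'L nm] : [/\ j != k, m \in ~: L, m' \in ~: L & m != m'].
  move: um; rewrite /= !inE !negb_or ![m == _]eq_sym ![m' == _]eq_sym.
  by do 6!case: (_ == _).
have L2 : #|L| = 2 by rewrite cards2 jk.
have S : forall m m', m \in ~: L -> m' \in ~: L -> before L m m' ->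
  `|ends_diff (m |: L) + \prod_(i | i \notin [:: j; k; m; m'])
       ((-1) ^+ neg i (vertex (m |: L)) * (-1) ^+ neg i (vertex (m' |: L)))
       * ends_diff (m' |: L)| <= 4 * line_jumps j k.
  move=> {um nm mL m'L} {}m {}m' mL m'L mm'.
  have := @chain_telescope _ _ (~: L) (before L) (before_irr L) (@before_trans L) _
    (fun l => ends_diff (l |: L)) (fun l => 2 * star_jumps (l |: L)) (-1) (normrN1 _) _ _
     m m' mL m'L mm'.
  rewrite -mulr_sumr mulrA -natrM -/(line_jumps j k) exprS mulN1r mulNr opprK.
  have -> : (-1) ^+ #|between (~: L) (before L) m m'| =
     \prod_(i | i \notin [:: j; k; m; m'])
       ((-1) ^+ neg i (vertex (m |: L)) * (-1) ^+ neg i (vertex (m' |: L))) :> R.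
    rewrite -prodr_const [LHS]big_mkcond [RHS]big_mkcond; apply: eq_bigr => i _.
    rewrite !inE !negb_or; case: (boolP (i == j)) => //= ij.
    case: (boolP (i == k)) => //= ik.
    case: (eqVneq i m) => [->|im] /=; first by rewrite before_irr.
    case: (eqVneq i m') => [->|im'] /=; first by rewrite before_irr andbF.
    have iL : i \in ~: L by rewrite !inE negb_or ij.
    have := mem_between L2 mL m'L mm' iL im im'; rewrite inE iL /= => ->.
    by case: neg; case: neg; rewrite /= ?expr0 ?expr1 ?mulr1 ?mul1r ?mulrNN ?mulr1.
  apply.
  - by move=> l l' lL l'L ll'; rewrite (before_total L2 lL l'L ll') orbN.
  - by move=> l; rewrite mulr_ge0 // star_jumps_ge0.
  - by move=> l l' lL l'L ll' none; apply: consec_ends_diff.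
have := before_total L2 mL m'L nm.
case: (boolP (before L m m')) => h; first by move=> _; exact: S.
move=> /= h'; have := S _ _ m'L mL h'.
have -> : \prod_(i | i \notin [:: j; k; m'; m])
     ((-1) ^+ neg i (vertex (m' |: L)) * (-1) ^+ neg i (vertex (m |: L))) =
   \prod_(i | i \notin [:: j; k; m; m'])
     ((-1) ^+ neg i (vertex (m |: L)) * (-1) ^+ neg i (vertex (m' |: L))) :> R.
  apply: eq_big => [i|i _]; last by rewrite mulrC.
  by rewrite !inE; congr (~~ (_ || (_ || _))); rewrite orbC.
set p := \prod_(i | _) _ => h2.
have p1 : `|p| = 1.
  rewrite normr_prod big1 // => i _.
  by rewrite normrM !normrX !normrN1 !expr1n mulr1.
have pp : p * p = 1.
  by rewrite -[p * p]expr2 -real_normK ?num_real // p1 expr1n.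
have -> : ends_diff (m |: L) + p * ends_diff (m' |: L) =
    p * (ends_diff (m' |: L) + p * ends_diff (m |: L)).
  by rewrite [RHS]mulrDr mulrA pp mul1r addrC.
by rewrite normrM p1 mul1r.
Qed.

(** Around the triangle with corners [k m], [k m'], [m m'] in the plane [j], the
    three sign products cancel, because each of them is a quotient of the signs
    attached to two corners.  What remains is one minus sign for each of the three
    sides, hence twice the difference is an error term. *)
Lemma triangle_ends_diff (j k m m' : I) : uniq [:: j; k; m; m'] ->
  `|ends_diff (m |: [set j; k]%SET)| <= 2 * (line_jumps j k + line_jumps j m' + line_jumps j m).
Proof.
move=> U.
have [U2 U3] : uniq [:: j; m'; k; m] /\ uniq [:: j; m; m'; k].
  move: U; rewrite /= !inE !negb_or ![m' == _]eq_sym ![m == _]eq_sym.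
  by do 6!case: (_ == _).
have := line_ends_diff U; have := line_ends_diff U2; have := line_ends_diff U3 => /=.
have E1 : (m' |: [set j; m])%SET = (m |: [set j; m'])%SET.
  by apply/setP => i; rewrite !inE; case: (i == j); case: (i == m); case: (i == m').
have E2 : (k |: [set j; m])%SET = (m |: [set j; k])%SET.
  by apply/setP => i; rewrite !inE; case: (i == j); case: (i == m); case: (i == k).
have E3 : (k |: [set j; m'])%SET = (m' |: [set j; k])%SET.
  by apply/setP => i; rewrite !inE; case: (i == j); case: (i == m'); case: (i == k).
rewrite E1 E2 E3.
set T1 := (m |: [set j; k])%SET; set T2 := (m' |: [set j; k])%SET.
set T3 := (m |: [set j; m'])%SET.
have P2 : (fun i => i \notin [:: j; m'; k; m]) =1 (fun i => i \notin [:: j; k; m; m']).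
  by move=> i /=; rewrite !inE; do 4!case: (i == _).
have P3 : (fun i => i \notin [:: j; m; m'; k]) =1 (fun i => i \notin [:: j; k; m; m']).
  by move=> i /=; rewrite !inE; do 4!case: (i == _).
rewrite (eq_bigl _ _ P2) (eq_bigl _ _ P3) !big_split /=.
set s1 := \prod_(i | _) (-1) ^+ neg i (vertex T1).
set s2 := \prod_(i | _) (-1) ^+ neg i (vertex T2).
set s3 := \prod_(i | _) (-1) ^+ neg i (vertex T3).
have sq (s : R) : `|s| = 1 -> s * s = 1.
  by move=> h; rewrite -[s * s]expr2 -real_normK ?num_real // h expr1n.
have s1n : `|s1| = 1.
  by rewrite normr_prod big1 // => i _; rewrite normrX normrN1 expr1n.
have s2n : `|s2| = 1.
  by rewrite normr_prod big1 // => i _; rewrite normrX normrN1 expr1n.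
have s3n : `|s3| = 1.
  by rewrite normr_prod big1 // => i _; rewrite normrX normrN1 expr1n.
move=> h3 h2 h1.
have E : 2 * ends_diff T1 = (ends_diff T1 + s1 * s2 * ends_diff T2)
    - s1 * s2 * (ends_diff T2 + s2 * s3 * ends_diff T3)
    + s1 * s3 * (ends_diff T3 + s3 * s1 * ends_diff T1).
  move: (ends_diff T1) (ends_diff T2) (ends_diff T3) => d1 d2 d3.
  transitivity (d1 + (s3 * s3) * (s1 * s1) * d1 + (1 - s2 * s2) * (s1 * s3 * d3)).
    by rewrite (sq _ s3n) (sq _ s1n) (sq _ s2n); ring.
  by ring.
have N2 : `|2 * ends_diff T1| = 2 * `|ends_diff T1| by rewrite normrM ger0_norm.
have : 2 * `|ends_diff T1| <= `|ends_diff T1 + s1 * s2 * ends_diff T2|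
  + `|ends_diff T2 + s2 * s3 * ends_diff T3| + `|ends_diff T3 + s3 * s1 * ends_diff T1|.
  rewrite -N2 E; apply: le_trans (ler_normD _ _) _.
  rewrite [ `|s1 * s3 * _|]normrM [ `|s1 * s3|]normrM s1n s3n !mul1r lerD2r.
  apply: le_trans (ler_normB _ _) _.
  by rewrite [ `|s1 * s2 * (_ + _)|]normrM [ `|s1 * s2|]normrM s1n s2n !mul1r.
lra.
Qed.

End Lines.

(** * Triples of planes and exchanges of one plane *)

Section Sums.
Variables (R : realFieldType).

Lemma sum_surj_le (A B : finType) (P : pred A) (Q : pred B) (s : A -> B)
    (f : B -> R) : (forall y, 0 <= f y) ->
    (forall y, Q y -> exists2 x, P x & s x = y) ->
  \sum_(y | Q y) f y <= \sum_(x | P x) f (s x).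
Proof.
move=> f0 H; rewrite [leRHS](partition_big s predT) //= [leLHS]big_mkcond.
apply: ler_sum => y _; case: (boolP (Q y)) => [/H[x Px sx]|_]; last first.
  by apply: sumr_ge0.
rewrite (bigD1 x) ?Px ?sx ?eqxx //= lerDl; exact: sumr_ge0.
Qed.

(** Multiplicities of at most [N] cost a factor [N]. *)
Lemma sum_fiber_le (A B : finType) (P : pred A) (Q : pred B) (s : A -> B)
    (f : B -> R) (N : nat) : (forall y, 0 <= f y) ->
    (forall x, P x -> Q (s x)) ->
    (forall y, (#|[set x | P x & s x == y]%SET| <= N)%N) ->
  \sum_(x | P x) f (s x) <= N%:R * \sum_(y | Q y) f y.
Proof.
move=> f0 PQ H; rewrite (partition_big s Q) //= mulr_sumr.
apply: ler_sum => y _; rewrite (eq_bigr (fun _ => f y)); last first.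
  by move=> x /andP[_ /eqP ->].
rewrite sumr_const -[leLHS]mulr_natl ler_wpM2r // ler_nat.
by apply: leq_trans (H y); rewrite cardsE.
Qed.

End Sums.

Section Johnson.
Variables (R : realFieldType) (I : finType).

Definition uniq3 (x : I * I * I) := uniq [:: x.1.1; x.1.2; x.2].
Definition set3 (x : I * I * I) : {set I} := (x.2 |: [set x.1.1; x.1.2])%SET.
Definition is3 (T : {set I}) := #|T| == 3.

Lemma card_set3 x : uniq3 x -> #|set3 x| = 3.
Proof.
rewrite /uniq3 off_pair => /andP[ij]; rewrite inE => kL.
by rewrite cardsU1 kL cards2 ij.
Qed.

(** Choosing a common element when there is one keeps the intermediate triples
    of an exchange sequence free of repetitions. *)
Lemma pick_apart (A B : {set I}) : (0 < #|A|)%N -> (0 < #|B|)%N ->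
  exists x y, [/\ x \in A, y \in B & y \notin A :\ x].
Proof.
move=> /card_gt0P[x xA] /card_gt0P[y yB].
case: (boolP (y \in A)) => yA; first by exists y, y; rewrite !inE eqxx.
by exists x, y; rewrite !inE (negbTE yA) andbF.
Qed.

(** The condition under which the coordinates of [x] can be replaced by those of
    [y] from left to right, with distinct coordinates at each stage. *)
Definition apart (x y : I * I * I) :=
  [&& uniq3 x, uniq3 y, y.1.1 != x.1.2, y.1.1 != x.2 & y.1.2 != x.2].

Lemma apart_orders (T T' : {set I}) : is3 T -> is3 T' ->
  exists x y, [/\ apart x y, set3 x = T & set3 y = T'].
Proof.
move=> /eqP T3 /eqP T'3.
have [||i [i' [iT i'T' hi]]] := @pick_apart T T'; rewrite ?T3 ?T'3 //.
have c1 : #|T :\ i| = 2 by have := cardsD1 i T; rewrite iT T3 add1n => -[<-].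
have c1' : #|T' :\ i'| = 2 by have := cardsD1 i' T'; rewrite i'T' T'3 add1n => -[<-].
have [||j [j' [jT j'T' hj]]] := @pick_apart (T :\ i) (T' :\ i'); rewrite ?c1 ?c1' //.
have c2 : #|T :\ i :\ j| = 1.
  by have := cardsD1 j (T :\ i); rewrite jT c1 add1n => -[<-].
have c2' : #|T' :\ i' :\ j'| = 1.
  by have := cardsD1 j' (T' :\ i'); rewrite j'T' c1' add1n => -[<-].
have /cards1P[k Ek] : #|T :\ i :\ j| == 1 by rewrite c2.
have /cards1P[k' Ek'] : #|T' :\ i' :\ j'| == 1 by rewrite c2'.
have kT : k \in T :\ i :\ j by rewrite Ek inE.
have k'T' : k' \in T' :\ i' :\ j' by rewrite Ek' inE.
have Ui : uniq3 (i, j, k).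
  move: jT kT; rewrite /uniq3 /= !inE => /andP[h1 h2] /and3P[h3 h4 h5].
  by rewrite negb_or [i == j]eq_sym [i == k]eq_sym [j == k]eq_sym h1 h3 h4.
have Ui' : uniq3 (i', j', k').
  move: j'T' k'T'; rewrite /uniq3 /= !inE => /andP[h1 h2] /and3P[h3 h4 h5].
  by rewrite negb_or [i' == j']eq_sym [i' == k']eq_sym [j' == k']eq_sym h1 h3 h4.
exists (i, j, k), (i', j', k'); split.
- rewrite /apart Ui Ui' /=; apply/and3P; split.
  + by apply: contraNneq hi => ->.
  + by apply: contraNneq hi => ->; case/setD1P: kT.
  + by apply: contraNneq hj => ->.
- apply/eqP; rewrite eqEcard card_set3 // T3 leqnn andbT /set3 /=.
  apply/fintype.subsetP => z; rewrite !inE.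
  case/setD1P: jT => _ jT; case/setD1P: kT => _ /setD1P[_ kT].
  by case/or3P => /eqP ->.
- apply/eqP; rewrite eqEcard card_set3 // T'3 leqnn andbT /set3 /=.
  apply/fintype.subsetP => z; rewrite !inE.
  case/setD1P: j'T' => _ j'T'; case/setD1P: k'T' => _ /setD1P[_ k'T'].
  by case/or3P => /eqP ->.
Qed.

Lemma set3_ordered T : is3 T -> exists2 x, uniq3 x & set3 x = T.
Proof.
by move=> T3; have [x [y [/and5P[ux _ _ _ _] <- _]]] := apart_orders T3 T3; exists x.
Qed.

Lemma sum_set3_ge (f : {set I} -> R) : (forall T, 0 <= f T) ->
  \sum_(T | is3 T) f T <= \sum_(x | uniq3 x) f (set3 x).
Proof. move=> f0; apply: sum_surj_le => // T; exact: set3_ordered. Qed.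

(** A triple has six orderings; [27], the number of maps from three positions to
    the triple, is a bound that needs no count. *)
Lemma sum_set3_le (f : {set I} -> R) : (forall T, 0 <= f T) ->
  \sum_(x | uniq3 x) f (set3 x) <= 27 * \sum_(T | is3 T) f T.
Proof.
move=> f0; apply: (sum_fiber_le (N := 27%N)) => // [x ux|T].
  by rewrite /is3 card_set3.
case: (eqVneq #|T| 3) => T3; last first.
  apply: leq_trans (_ : 0 <= _)%N => //; rewrite leqn0 cards_eq0; apply/eqP/setP => x.
  rewrite !inE; apply: contraNF T3 => /andP[ux /eqP <-].
  by rewrite card_set3.
have -> : 27%N = #|finset.setX (finset.setX T T) T| by rewrite !cardsX T3.
apply: subset_leq_card; apply/fintype.subsetP => -[[i j] k].
rewrite !inE => /andP[_ /eqP <-]; rewrite /set3 /= !inE !eqxx /= !orbT //.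
Qed.

Lemma sum_triple (F : I -> I -> I -> R) :
  \sum_x F x.1.1 x.1.2 x.2 = \sum_i \sum_j \sum_k F i j k.
Proof.
rewrite pair_bigA /=.
by rewrite (pair_bigA _ (fun (p : I * I) k => F p.1 p.2 k)).
Qed.

Variables (h : {set I} -> R) (slack : I -> I -> R).
Hypothesis slack_ge0 : forall u v, 0 <= slack u v.
Hypothesis h_line : forall u v w w', uniq [:: u; v; w] -> uniq [:: u; v; w'] ->
  (h (w |: [set u; v])%SET - h (w' |: [set u; v])%SET) ^+ 2 <= slack u v.

(** One exchange at a time; each moves along the line of the two planes kept. *)
Lemma apart_diff x y : apart x y ->
  (h (set3 x) - h (set3 y)) ^+ 2 <=
    3 * (slack x.1.2 x.2 + slack y.1.1 x.2 + slack y.1.1 y.1.2).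
Proof.
case: x y => [[i j] k] [[i' j'] k']; rewrite /apart /uniq3 /set3 /=.
case/and5P => ux uy h1 h2 h3.
have E1 : (k |: [set i; j] = i |: [set j; k])%SET.
  by apply/setP => z; rewrite !inE; do 3!case: (z == _).
have E2 : (i' |: [set j; k] = j |: [set i'; k])%SET.
  by apply/setP => z; rewrite !inE; do 3!case: (z == _).
have E3 : (j' |: [set i'; k] = k |: [set i'; j'])%SET.
  by apply/setP => z; rewrite !inE; do 3!case: (z == _).
have A1 : uniq [:: j; k; i] /\ uniq [:: j; k; i'].
  move: ux h1 h2; rewrite /= !inE !negb_or ![i == _]eq_sym ![i' == _]eq_sym.
  by do 5!case: (_ == _).
have A2 : uniq [:: i'; k; j] /\ uniq [:: i'; k; j'].
  move: ux uy h1 h2 h3; rewrite /= !inE !negb_or ![j == _]eq_sym ![j' == _]eq_sym.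
  by do 9!case: (_ == _).
have A3 : uniq [:: i'; j'; k] /\ uniq [:: i'; j'; k'].
  move: uy h1 h2 h3; rewrite /= !inE !negb_or.
  by do 6!case: (_ == _).
have L1 := h_line A1.1 A1.2; have L2 := h_line A2.1 A2.2.
have L3 := h_line A3.1 A3.2.
rewrite -E1 E2 in L1; rewrite E3 in L2.
move: L1 L2 L3; set p0 := h _; set p1 := h _; set p2 := h _; set p3 := h _.
move=> L1 L2 L3.
have : 0 <= ((p0 - p1) - (p1 - p2)) ^+ 2 by rewrite sqr_ge0.
have : 0 <= ((p0 - p1) - (p2 - p3)) ^+ 2 by rewrite sqr_ge0.
have : 0 <= ((p2 - p3) - (p1 - p2)) ^+ 2 by rewrite sqr_ge0.
move: (slack _ _) (slack _ _) (slack _ _) L1 L2 L3 => e1 e2 e3; nra.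
Qed.

(** Each pair of triples is joined by three exchanges, and each exchange along
    the line [u v] is used by at most [#|I| ^ 4] ordered pairs of ordered triples,
    as these are determined by their four other coordinates. *)
Lemma johnson :
  \sum_(T | is3 T) \sum_(T' | is3 T') (h T - h T') ^+ 2 <=
    9 * #|I|%:R ^+ 4 * \sum_u \sum_v slack u v.
Proof.
set E := \sum_u \sum_v slack u v; set n : R := #|I|%:R.
rewrite pair_big_dep /=.
apply: le_trans (_ : \sum_(z | apart z.1 z.2) (h (set3 z.1) - h (set3 z.2)) ^+ 2 <= _).
  apply: (@sum_surj_le _ _ _ _ _ (fun z => (set3 z.1, set3 z.2))
     (fun w => (h w.1 - h w.2) ^+ 2)); first by move=> w; rewrite sqr_ge0.
  move=> [T T'] /= /andP[T3 T'3].
  by have [x [y [xy <- <-]]] := apart_orders T3 T'3; exists (x, y).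
apply: le_trans (_ : \sum_(z | apart z.1 z.2)
   3 * (slack z.1.1.2 z.1.2 + slack z.2.1.1 z.1.2 + slack z.2.1.1 z.2.1.2) <= _).
  by apply: ler_sum => z; exact: apart_diff.
apply: le_trans (_ : \sum_z
   3 * (slack z.1.1.2 z.1.2 + slack z.2.1.1 z.1.2 + slack z.2.1.1 z.2.1.2) <= _).
  rewrite [leLHS]big_mkcond; apply: ler_sum => z _; case: ifP => // _.
  by rewrite mulr_ge0 ?addr_ge0.
rewrite -mulr_sumr !big_split /=.
rewrite -(pair_bigA _ (fun (x y : I * I * I) => slack x.1.2 x.2)).
rewrite -(pair_bigA _ (fun (x y : I * I * I) => slack y.1.1 x.2)).
rewrite -(pair_bigA _ (fun (x y : I * I * I) => slack y.1.1 y.1.2)) /=.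
have cI : #|{: I * I * I}|%:R = n ^+ 3 :> R.
  by rewrite !card_prod -natrX; congr (_ %:R); rewrite !expnS expn0 muln1 mulnA.
have -> : \sum_(x : I * I * I) \sum_(y : I * I * I) slack x.1.2 x.2 = n ^+ 4 * E.
  under eq_bigr do rewrite sumr_const -mulr_natl cI.
  rewrite -mulr_sumr (sum_triple (fun i j k => slack j k)) sumr_const -mulr_natl.
  by rewrite -/E -/n; ring.
have -> : \sum_(x : I * I * I) \sum_(y : I * I * I) slack y.1.1 y.1.2 = n ^+ 4 * E.
  rewrite sumr_const -mulr_natl cI (sum_triple (fun i j k => slack i j)).
  under eq_bigr do under eq_bigr do rewrite sumr_const -mulr_natl.
  under eq_bigr do rewrite -mulr_sumr.
  by rewrite -mulr_sumr -/E -/n; ring.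
have -> : \sum_(x : I * I * I) \sum_(y : I * I * I) slack y.1.1 x.2 = n ^+ 4 * E.
  have fiber k : \sum_(y : I * I * I) slack y.1.1 k = n ^+ 2 * \sum_u slack u k.
    rewrite (sum_triple (fun i' _ _ => slack i' k)).
    under eq_bigr do rewrite !sumr_const -mulrnA -mulr_natl.
    by rewrite -mulr_sumr natrM.
  under eq_bigr do rewrite fiber.
  rewrite (sum_triple (fun i j k => n ^+ 2 * \sum_u slack u k)) !sumr_const.
  rewrite -mulrnA -[LHS]mulr_natl natrM -mulr_sumr exchange_big -/E -/n /=; ring.
by apply: eqr_le; ring.
Qed.

End Johnson.

(** * The Poincare inequality on sign vectors *)

Section Cube.
Variables (R : realFieldType) (I : finType) (phi : {ffun I -> bool} -> R).

(** Flip the coordinates of [T] one at a time; each flip doubles the constant. *)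
Lemma cube_le (C : pred {ffun I -> bool}) (T : {set I}) :
    (forall s t, t \in T -> C (flip s t) = C s) ->
  forall s s' : {ffun I -> bool}, C s -> (forall i, i \notin T -> s i = s' i) ->
    (phi s - phi s') ^+ 2 <=
      2 ^+ #|T| * \sum_(t in T) \sum_(r | C r) jump phi r t ^+ 2.
Proof.
move Ek: #|T| => k; elim: k T Ek => [|k IH] T Ek CT s s' Cs ss'.
  have T0 : T = finset.set0 by apply/eqP; rewrite -cards_eq0 Ek.
  have -> : s = s' by apply/ffunP => i; apply: ss'; rewrite T0 inE.
  by rewrite subrr expr0n mulr_ge0 ?sumr_ge0 // => t _; apply: sumr_ge0 => r _; rewrite sqr_ge0.
(* [s1] is [s] corrected at the coordinate [t]. *)
have [t tT] : exists t, t \in T by apply/card_gt0P; rewrite Ek.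
have cT : #|T :\ t| = k by have := cardsD1 t T; rewrite tT Ek add1n => -[<-].
pose s1 := if s t == s' t then s else flip s t.
have Cs1 : C s1 by rewrite /s1; case: ifP => // _; rewrite CT.
have H1 : (phi s1 - phi s') ^+ 2 <= 2 ^+ k * \sum_(u in T :\ t) \sum_(r | C r) jump phi r u ^+ 2.
  apply: IH => // [s2 u /setD1P[_ uT]|i]; first exact: CT.
  rewrite !inE negb_and negbK; case: (eqVneq i t) => [-> _|it iT].
    rewrite /s1; case: eqP => // ; rewrite ffunE eqxx addbT.
    by case: (s t); case: (s' t).
  rewrite -ss' // /s1; case: ifP => // _; by rewrite ffunE (negbTE it) addbF.
have H2 : (phi s - phi s1) ^+ 2 <= \sum_(r | C r) jump phi r t ^+ 2.
  rewrite (bigD1 s) //= /jump real_normK ?num_real //.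
  apply: (@le_trans _ _ ((phi s - phi (flip s t)) ^+ 2)).
    by rewrite /s1; case: ifP => // _; rewrite subrr expr0n sqr_ge0.
  by rewrite lerDl sumr_ge0 // => r _; rewrite sqr_ge0.
rewrite (big_setD1 t) //= [2 ^+ k.+1]exprS mulrDr.
set A := \sum_(r | C r) _ in H2 *; set B := \sum_(u in T :\ t) _ in H1 *.
have A0 : 0 <= A by apply: sumr_ge0 => r _; rewrite sqr_ge0.
have k1 : 1 <= 2 ^+ k :> R by rewrite exprn_ege1 // ler1n.
have : (phi s - phi s') ^+ 2 <= 2 * (phi s - phi s1) ^+ 2 + 2 * (phi s1 - phi s') ^+ 2.
  have : 0 <= ((phi s - phi s1) - (phi s1 - phi s')) ^+ 2 by rewrite sqr_ge0.
  by nra.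
have : A <= 2 ^+ k * A by rewrite ler_peMl.
have -> : 2 * 2 ^+ k * A + 2 * 2 ^+ k * B = 2 * (2 ^+ k * A) + 2 * (2 ^+ k * B).
  by rewrite !mulrA.
move: (2 ^+ k * B) (2 ^+ k * A) H1 H2 => x y; lra.
Qed.

End Cube.

Section Poincare.
Variables (R : realFieldType) (I : finType).
Variables (a : I -> 'cV[R]_3) (b : I -> R).
Hypothesis gp : generic_planes a b.
Variable phi : {ffun I -> bool} -> R.

Local Notation vertex := (vertex a b).
Local Notation low := (low a b).
Local Notation high := (high a b).
Local Notation at_vertex := (at_vertex a b).
Local Notation star_jumps := (star_jumps a b phi).
Local Notation line_jumps := (line_jumps a b phi).
Local Notation ends_sum := (ends_sum a b phi).
Local Notation ends_diff := (ends_diff a b phi).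
Local Notation jump := (jump phi).
Local Notation n := (#|I|%:R : R).

Definition realized s : bool := `[< face a b s finset.set0 >].
Definition valence s := #|[set m | realized (flip s m)]%SET|.
(** The Dirichlet form of the chamber graph, read on sign vectors. *)
Definition energy := \sum_(s | realized s) \sum_(m | realized (flip s m)) jump s m ^+ 2.

Lemma realized_at T s : is3 T -> at_vertex T s -> realized s.
Proof. by move=> /eqP T3 h; apply/asboolP; apply: (at_vertex_realized gp T3). Qed.

Lemma realized_flip_at T s t : is3 T -> t \in T -> at_vertex T s -> realized (flip s t).
Proof. by move=> T3 tT h; apply: (realized_at T3); rewrite at_vertex_flip. Qed.

Lemma energy_ge0 : 0 <= energy.
Proof. by apply: sumr_ge0 => s _; apply: sumr_ge0 => m _; rewrite sqr_ge0. Qed.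

Let gain s := \sum_(m | realized (flip s m)) jump s m ^+ 2.
Let gain0 s : 0 <= gain s. Proof. by apply: sumr_ge0 => m _; rewrite sqr_ge0. Qed.

(** A chamber is selected by at most one triple, so distinct triples charge
    distinct facets. *)
Lemma selected_le (sel : {set I} -> {ffun I -> bool}) :
    (forall T, at_vertex T (sel T)) ->
    (forall T T', is3 T -> is3 T' -> sel T = sel T' -> T = T') ->
  \sum_(T | is3 T) \sum_(t in T) jump (sel T) t ^+ 2 <= energy.
Proof.
move=> sel_at sel_inj.
apply: le_trans (_ : \sum_(T | is3 T) gain (sel T) <= _).
  apply: ler_sum => T T3; rewrite [leLHS]big_mkcond [leRHS]big_mkcond /=.
  apply: ler_sum => t _; case: ifP => tT; last by case: ifP; rewrite ?sqr_ge0.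
  by rewrite (realized_flip_at T3).
rewrite -[energy]mul1r; apply: (sum_fiber_le (N := 1%N)) => // [T T3|s].
  exact: (realized_at T3).
case: (set_0Vmem [set T | is3 T & sel T == s]%SET) => [->|[T]]; first by rewrite cards0.
rewrite inE => /andP[T3 /eqP sT]; rewrite -(cards1 T); apply: subset_leq_card.
apply/fintype.subsetP => T'; rewrite !inE => /andP[T'3 /eqP sT'].
by apply/eqP; apply: sel_inj => //; rewrite sT.
Qed.

Lemma sum_star_jumps_le : \sum_(T | is3 T) star_jumps T ^+ 2 <= 12 * energy.
Proof.
have l_le := selected_le (@low_at _ _ a b)
   (fun T T' T3 T'3 => low_inj gp (eqP T3) (eqP T'3)).
have h_le := selected_le (@high_at _ _ a b)
   (fun T T' T3 T'3 => high_inj gp (eqP T3) (eqP T'3)).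
apply: le_trans (_ : \sum_(T | is3 T)
   (6 * \sum_(t in T) jump (low T) t ^+ 2 + 6 * \sum_(t in T) jump (high T) t ^+ 2) <= _).
  apply: ler_sum => T /eqP T3; rewrite /star_jumps.
  apply: le_trans (sqr_sum_le _ _) _; rewrite T3 -mulrDr -big_split /=.
  rewrite !mulr_sumr; apply: ler_sum => t _.
  have : 0 <= (jump (low T) t - jump (high T) t) ^+ 2 by rewrite sqr_ge0.
  by nra.
rewrite big_split /= -!mulr_sumr; lra.
Qed.

Let slack u v : R := if u != v then 16 * line_jumps u v ^+ 2 else 0.

Let slack_ge0 u v : 0 <= slack u v.
Proof. by rewrite /slack; case: ifP => // _; rewrite mulr_ge0 ?sqr_ge0. Qed.

(** A line carries at most [n] vertices, and a vertex lies on three lines. *)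
Lemma sum_slack_le : \sum_u \sum_v slack u v <= 432 * n * \sum_(T | is3 T) star_jumps T ^+ 2.
Proof.
apply: le_trans (_ : 16 * n * \sum_(x | uniq3 x) star_jumps (set3 x) ^+ 2 <= _); last first.
  have := sum_set3_le (f := fun T => star_jumps T ^+ 2) (fun T => sqr_ge0 _).
  have n0 : 0 <= n by rewrite ler0n.
  move: (\sum_(x | uniq3 x) _) (\sum_(T | is3 T) _) => x y H.
  have := ler_wpM2l n0 H; lra.
rewrite [X in _ <= _ * X]big_mkcond /=.
rewrite (sum_triple (fun i j k => if uniq3 (i, j, k) then star_jumps (set3 (i, j, k)) ^+ 2 else 0)).
rewrite mulr_sumr; apply: ler_sum => u _.
rewrite mulr_sumr; apply: ler_sum => v _; rewrite /slack.
case: ifP => [uv|_]; last first.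
  by rewrite !mulr_ge0 // sumr_ge0 // => k _; case: ifP => // _; rewrite sqr_ge0.
rewrite -mulrA ler_wpM2l //; apply: le_trans (sqr_sum_le _ _) _.
apply: ler_pM; rewrite ?ler0n ?ler_nat ?max_card //.
  by apply: sumr_ge0 => l _; rewrite sqr_ge0.
rewrite [leLHS]big_mkcond; apply: ler_sum => l _.
by rewrite /uniq3 off_pair /= uv.
Qed.

Lemma ends_sum_line u v w w' : uniq [:: u; v; w] -> uniq [:: u; v; w'] ->
  (ends_sum (w |: [set u; v])%SET - ends_sum (w' |: [set u; v])%SET) ^+ 2 <= slack u v.
Proof.
move=> U U'; have := line_ends_sum gp phi U U'.
have -> : slack u v = (4 * line_jumps u v) ^+ 2.
  by rewrite /slack; move: U; rewrite off_pair => /andP[-> _]; ring.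
exact: sqr_le_norm.
Qed.

Lemma ends_diff_triangle (j k m m' : I) : uniq [:: j; k; m; m'] ->
  ends_diff (m |: [set j; k]%SET) ^+ 2 <= slack j k + slack j m' + slack j m.
Proof.
move=> U; have := triangle_ends_diff gp phi U.
have [jk jm jm'] : [/\ j != k, j != m & j != m'].
  by move: U; rewrite /= !inE !negb_or => /and3P[/and3P[-> -> ->]].
rewrite /slack jk jm jm' => H.
apply: (@le_trans _ _ ((2 * (line_jumps j k + line_jumps j m' + line_jumps j m)) ^+ 2)).
  exact: sqr_le_norm.
move: (line_jumps j k) (line_jumps j m') (line_jumps j m) => x y z.
have := sqr_ge0 (x - y); have := sqr_ge0 (x - z); have := sqr_ge0 (y - z).
have := sqr_ge0 x; have := sqr_ge0 y; have := sqr_ge0 z.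
have -> : (2 * (x + y + z)) ^+ 2 = 12 * x ^+ 2 + 12 * y ^+ 2 + 12 * z ^+ 2
    - 4 * (x - y) ^+ 2 - 4 * (x - z) ^+ 2 - 4 * (y - z) ^+ 2 by ring.
lra.
Qed.

Hypothesis n4 : (4 <= #|I|)%N.

Let n_ge4 : 4 <= n. Proof. by rewrite ler_nat. Qed.

Lemma sum_constI (c : R) : \sum_(i : I) c = n * c.
Proof. by rewrite sumr_const -[LHS]mulr_natl. Qed.

(** Averaging over the [n - 3] choices of the fourth plane [m'] spreads the load of
    the triangles evenly over the lines. *)
Lemma sum_ends_diff_le : \sum_(T | is3 T) ends_diff T ^+ 2 <= 12 * n * \sum_u \sum_v slack u v.
Proof.
set E := \sum_u \sum_v slack u v.
have E0 : 0 <= E by apply: sumr_ge0 => u _; apply: sumr_ge0.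
have K : (n - 3) * \sum_(x | uniq3 x) ends_diff (set3 x) ^+ 2 <= 3 * n ^+ 2 * E.
  rewrite mulr_sumr.
  apply: le_trans (_ : \sum_(x | uniq3 x) \sum_(m' | m' \notin set3 x)
     (slack x.1.1 x.1.2 + slack x.1.1 m' + slack x.1.1 x.2) <= _).
    apply: ler_sum => x ux.
    apply: le_trans (_ : \sum_(m' | m' \notin set3 x) ends_diff (set3 x) ^+ 2 <= _).
      rewrite sumr_const -[leRHS]mulr_natl ler_wpM2r ?sqr_ge0 //.
      have -> : #|(fun m' => m' \notin set3 x)| = (#|I| - 3)%N.
        have := cardC (set3 x); rewrite (card_set3 ux) => E3.
        by rewrite -E3 addKn; apply: eq_card => i; rewrite !inE.
      by rewrite natrB // ltnW.
    apply: ler_sum => m' m'N; apply: ends_diff_triangle.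
    move: ux m'N; rewrite /uniq3 /set3 /= !inE !negb_or ![m' == _]eq_sym.
    by do 6!case: (_ == _).
  apply: le_trans (_ : \sum_x \sum_m'
     (slack x.1.1 x.1.2 + slack x.1.1 m' + slack x.1.1 x.2) <= _).
    rewrite [leLHS]big_mkcond; apply: ler_sum => x _; case: ifP => _; last first.
      by apply: sumr_ge0 => m' _; rewrite !addr_ge0.
    rewrite [leLHS]big_mkcond; apply: ler_sum => m' _; case: ifP => // _.
    by rewrite !addr_ge0.
  rewrite (sum_triple (fun j k m => \sum_m' (slack j k + slack j m' + slack j m))).
  pose S j := \sum_v slack j v.
  have ES : E = \sum_j S j by [].
  rewrite ES mulr_sumr; apply: ler_sum => j _.
  have -> : \sum_k \sum_m \sum_m' (slack j k + slack j m' + slack j m) = 3 * n ^+ 2 * S j.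
    under eq_bigr => k _.
      under eq_bigr => m _ do rewrite !big_split /= !sum_constI -/(S j).
      rewrite !big_split /= !sum_constI -mulr_sumr -/(S j).
      over.
    by rewrite !big_split /= !sum_constI -!mulr_sumr -/(S j); ring.
  by [].
have S0 := sum_set3_ge (f := fun T => ends_diff T ^+ 2) (fun T => sqr_ge0 _).
apply: le_trans S0 _; move: K; set y := \sum_(x | _) _.
have y0 : 0 <= y by apply: sumr_ge0 => x _; rewrite sqr_ge0.
move=> K; have n1 := n_ge4.
have : n * y <= n * (12 * n * E).
  apply: (@le_trans _ _ (4 * ((n - 3) * y))); last first.
    apply: le_trans (ler_wpM2l _ K) _ => //; apply: eqr_le; ring.
  by rewrite mulrA ler_wpM2r //; lra.
by rewrite ler_pM2l //; lra.
Qed.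

Lemma card_is3 : n ^+ 3 <= 16 * #|@is3 I|%:R /\ (0 < #|@is3 I|)%N.
Proof.
have E : #|@is3 I| = 'C(#|I|, 3).
  by rewrite -card_draws; apply: eq_card => T; rewrite !inE.
rewrite E; split; last by rewrite bin_gt0 ltnW.
have F : ('C(#|I|, 3) * 6 = #|I| * #|I|.-1 * #|I|.-2)%N.
  by rewrite -[6%N]/(3`!) bin_ffact !ffactnS ffactn0 muln1 mulnA.
have : (#|I| ^ 3 * 6 <= 16 * ('C(#|I|, 3) * 6))%N.
  rewrite F; move: #|I| n4 => [|[|[|[|k]]]] // _; rewrite /= !expnS expn0 muln1.
  nia.
rewrite mulnA leq_pmul2r // => H.
by rewrite -natrX -natrM ler_nat.
Qed.

(** The value at [low T] is the half-sum of [ends_sum T] and [ends_diff T]: the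
    first has small variance and the second is small. *)
Lemma low_variance : exists c,
  \sum_(T | is3 T) (phi (low T) - c) ^+ 2 <= (48 * 432) * 12 * (n ^+ 2 * energy).
Proof.
have [N1 N0] := card_is3.
have [c /= Ec] := variance_mean (fun T => phi (low T)) N0; exists c.
set Y := \sum_(T | is3 T) _ in Ec *.
set N : R := #|is3 (I:=I)|%:R in N1 Ec.
have NN0 : 0 < N by rewrite ltr0n.
have J := johnson slack_ge0 ends_sum_line.
have D := sum_ends_diff_le; have L := sum_slack_le; have S := sum_star_jumps_le.
set Q := \sum_(T | is3 T) ends_diff T ^+ 2 in D.
set P := \sum_(T | is3 T) \sum_(T' | is3 T') _ in J.
set E := \sum_u \sum_v slack u v in J D L.
have H : 2 * N * Y <= 2^-1 * P + 2 * (N * Q).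
  rewrite Ec /P mulr_sumr.
  have -> : 2 * (N * Q) = \sum_(T | is3 T) (N * ends_diff T ^+ 2 + Q).
    rewrite big_split /= -mulr_sumr sumr_const -/Q -[Q *+ _]mulr_natl -/N; ring.
  rewrite -big_split; apply: ler_sum => T T3 /=.
  have -> : N * ends_diff T ^+ 2 + Q = \sum_(T' | is3 T') (ends_diff T ^+ 2 + ends_diff T' ^+ 2).
    by rewrite big_split /= sumr_const -/Q -[_ *+ _]mulr_natl -/N.
  rewrite mulr_sumr -big_split; apply: ler_sum => T' T'3 /=.
  rewrite /ends_sum /ends_diff.
  move: (phi (low T)) (phi (high T)) (phi (low T')) (phi (high T')) => f g f' g'.
  have := sqr_ge0 ((f - g) + (f' - g')).
  have := sqr_ge0 ((f + g) - (f' + g') - ((f - g) - (f' - g'))).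
  nra.
have E0 : 0 <= energy := energy_ge0.
have n1 := n_ge4.
have LL : E <= 432 * 12 * (n * energy).
  have n0 : 0 <= n by rewrite ler0n.
  by have := ler_wpM2l n0 S; lra.
have {}D : Q <= 12 * 432 * 12 * (n ^+ 2 * energy).
  apply: le_trans D _; apply: le_trans (ler_wpM2l _ LL) _; first by rewrite mulr_ge0 ?ler0n.
  by apply: eqr_le; ring.
have {}J : P <= 16 * N * (9 * 432 * 12 * (n ^+ 2 * energy)).
  apply: le_trans J _; apply: le_trans (ler_wpM2l _ LL) _.
    by rewrite mulr_ge0 // exprn_ge0 ?ler0n.
  apply: (@le_trans _ _ (n ^+ 3 * (9 * 432 * 12 * (n ^+ 2 * energy)))).
    by apply: eqr_le; ring.
  have W0 : 0 <= n ^+ 2 * energy by rewrite mulr_ge0 ?exprn_ge0 ?ler0n.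
  by apply: ler_wpM2r N1; move: (_ * energy) W0 => w; lra.
set W := n ^+ 2 * energy in D J *.
have NQ : N * Q <= N * (12 * 432 * 12 * W) by rewrite ler_pM2l.
have : N * Y <= N * (48 * 432 * 12 * W) by lra.
by rewrite ler_pM2l.
Qed.

Lemma is3_ge (j : I) : (#|[set T | is3 T & j \in T]%SET| <= #|I| ^ 2)%N.
Proof.
have -> : (#|I| ^ 2 = #|{: I * I}|)%N by rewrite card_prod expnS expn1.
apply: leq_trans (leq_imset_card (fun p : I * I => (p.2 |: [set j; p.1])%SET) predT).
apply: subset_leq_card; apply/fintype.subsetP => T; rewrite inE => /andP[/eqP T3 jT].
have c1 : #|T :\ j| == 2 by have := cardsD1 j T; rewrite jT T3 add1n => -[<-].
have /cards2P[k [l [kl E]]] := c1.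
apply/imsetP; exists (k, l) => //=; rewrite -(finset.setD1K jT) E.
by apply/setP => z; rewrite !inE; do 3!case: (z == _).
Qed.

(** Here a facet may be charged once for each of its vertices; this crude count is
    affordable since no line is followed. *)
Lemma sum_at_vertex_le :
  \sum_(T | is3 T) \sum_(t in T) \sum_(s | at_vertex T s) jump s t ^+ 2
    <= n ^+ 2 * energy.
Proof.
apply: le_trans (_ : \sum_(T | is3 T) \sum_(s | realized s) \sum_(t | realized (flip s t))
   (t \in T)%:R * jump s t ^+ 2 <= _).
  apply: ler_sum => T T3; rewrite exchange_big /= [leLHS]big_mkcond [leRHS]big_mkcond.
  apply: ler_sum => s _; case: ifP => sT; last first.
    case: ifP => // _; apply: sumr_ge0 => t _; by rewrite mulr_ge0 ?sqr_ge0 ?ler0n.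
  rewrite (realized_at T3 sT) [leLHS]big_mkcond [leRHS]big_mkcond; apply: ler_sum => t _.
  case: ifP => tT; first by rewrite (realized_flip_at T3 tT sT) mul1r.
  by case: ifP => // _; rewrite mul0r.
rewrite exchange_big /= mulr_sumr; apply: ler_sum => s _.
rewrite exchange_big /= mulr_sumr; apply: ler_sum => t _.
rewrite -mulr_suml ler_wpM2r ?sqr_ge0 // -natrX -natr_sum ler_nat.
apply: leq_trans (is3_ge t); rewrite -sum1_card big_mkcond /= [X in (_ <= X)%N]big_mkcond /=.
by apply: leq_sum => T _; rewrite inE; case: (is3 T); case: (t \in T).
Qed.

(** Each facet has a vertex, and three facets of a chamber meet at a vertex. *)
Lemma valence_le s : realized s ->
  (valence s <= 3 * #|[set T | is3 T & at_vertex T s]%SET|)%N.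
Proof.
move=> rs; have fs : face a b s finset.set0 by apply/asboolP.
have key m : realized (flip s m) -> exists T, [/\ is3 T, at_vertex T s & m \in T].
  move=> /asboolP fm; have [T [mT fT cT]] := face_full gp (face_mid fs fm).
  have T3 : #|T| = 3 by rewrite cT; apply/minn_idPl; apply: ltnW.
  exists T; split; first by rewrite /is3 T3.
    exact: (face_at_vertex gp T3 fT).
  by rewrite -finset.sub1set.
set A := [set T | _]%SET.
apply: leq_trans (_ : \sum_m \sum_(T in A) (m \in T) <= _)%N.
  rewrite /valence -sum1_card big_mkcond; apply: leq_sum => m _.
  rewrite inE; case: ifP => // /key [T [T3 sT mT]].
  by rewrite (bigD1 T) ?inE ?T3 ?sT //= mT.
rewrite exchange_big /= mulnC -sum_nat_const; apply: leq_sum => T.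
rewrite inE => /andP[/eqP T3 _]; rewrite -[3%N]T3 -sum1_card [X in (_ <= X)%N]big_mkcond.
by apply: leq_sum => m _; case: (m \in T).
Qed.

Lemma sum_valence_le (f : {ffun I -> bool} -> R) : (forall s, 0 <= f s) ->
  \sum_(s | realized s) (valence s)%:R * f s <=
     3 * \sum_(T | is3 T) \sum_(s | at_vertex T s) f s.
Proof.
move=> f0; apply: le_trans (_ : \sum_(s | realized s)
   (3 * #|[set T | is3 T & at_vertex T s]%SET|)%:R * f s <= _).
  by apply: ler_sum => s rs; rewrite ler_wpM2r // ler_nat valence_le.
rewrite (exchange_big_dep realized) /=; last by move=> T s; exact: realized_at.
rewrite mulr_sumr; apply: ler_sum => s rs.
rewrite natrM -mulrA ler_wpM2l // sumr_const -[leRHS]mulr_natl ler_wpM2r //.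
by rewrite ler_nat cardsE.
Qed.

Lemma valence_total : (\sum_(s | realized s) valence s)%:R <= 4 * n ^+ 3.
Proof.
rewrite natr_sum; apply: le_trans (_ : \sum_(s | realized s) (valence s)%:R * 1 <= _).
  by apply: ler_sum => s _; rewrite mulr1.
apply: le_trans (sum_valence_le (fun _ => ler01)) _.
apply: le_trans (_ : 3 * \sum_(T : {set I} | is3 T) 8 <= _).
  rewrite ler_wpM2l //; apply: ler_sum => T /eqP T3.
  rewrite sumr_const ler_nat.
  by have := card_at_vertex a b T; rewrite T3 cardsE.
rewrite sumr_const -[_ *+ _]mulr_natl.
have E : #|@is3 I| = 'C(#|I|, 3).
  by rewrite -card_draws; apply: eq_card => T; rewrite !inE.
have : ('C(#|I|, 3) * 6 <= #|I| ^ 3)%N.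
  rewrite -[6%N]/(3`!) bin_ffact !ffactnS ffactn0 muln1 !expnS expn0 muln1.
  by rewrite leq_mul2l leq_mul ?orbT // ; lia.
rewrite -(ler_nat R) natrM natrX -E; lra.
Qed.

(** Replace a chamber by the vertices on its boundary, compare it there with
    [low T] inside the cube of the eight chambers at [T], and apply
    [low_variance]. *)
Lemma poincare_many : exists c,
  \sum_(s | realized s) (valence s)%:R * (phi s - c) ^+ 2 <=
    6 * (64 + 8 * (48 * 432 * 12)) * n ^+ 2 * energy.
Proof.
have [c Hc] := low_variance; exists c.
apply: le_trans (sum_valence_le _) _; first by move=> s; rewrite sqr_ge0.
have V := sum_at_vertex_le.
set W := n ^+ 2 * energy in Hc V.
apply: le_trans (_ : 3 * \sum_(T | is3 T)
   (2 * 64 * \sum_(t in T) \sum_(s | at_vertex T s) jump s t ^+ 2 +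
    2 * 8 * (phi (low T) - c) ^+ 2) <= _); last first.
  by rewrite big_split /= -!mulr_sumr -[leRHS]mulrA -/W; lra.
rewrite ler_wpM2l //; apply: ler_sum => T T3.
set Z := \sum_(t in T) _.
have card8 : #|at_vertex T|%:R <= 8 :> R.
  rewrite ler_nat; have := card_at_vertex a b T; rewrite (eqP T3) cardsE.
  by [].
have Z0 : 0 <= Z.
  by apply: sumr_ge0 => t _; apply: sumr_ge0 => s _; rewrite sqr_ge0.
apply: le_trans (_ : \sum_(s | at_vertex T s) (2 * (8 * Z) + 2 * (phi (low T) - c) ^+ 2) <= _).
  apply: ler_sum => s sT.
  have h : (phi s - phi (low T)) ^+ 2 <= 8 * Z.
    have -> : 8 = 2 ^+ #|T| :> R by rewrite (eqP T3); ring.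
    apply: (@cube_le _ _ phi (at_vertex T)) => //.
    - by move=> s' t tT; rewrite at_vertex_flip.
    move=> i iT; move/at_vertexP: sT => ->//.
    by have /at_vertexP -> := low_at a b T.
  have := sqr_ge0 ((phi s - phi (low T)) - (phi (low T) - c)).
  nra.
rewrite sumr_const -[leLHS]mulr_natl.
have X0 : 0 <= 2 * (8 * Z) + 2 * (phi (low T) - c) ^+ 2.
  by rewrite addr_ge0 // mulr_ge0 ?sqr_ge0 // mulr_ge0.
by apply: le_trans (ler_wpM2r X0 card8) _; lra.
Qed.

End Poincare.

Section FewPlanes.
Variables (R : realFieldType) (I : finType).
Variables (a : I -> 'cV[R]_3) (b : I -> R).
Hypothesis gp : generic_planes a b.
Hypothesis n3 : (#|I| <= 3)%N.
Variable phi : {ffun I -> bool} -> R.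
Local Notation realized := (realized a b).
Local Notation valence := (valence a b).
Local Notation energy := (energy a b phi).

(** At most three planes in general position have a common point, around which
    all signs occur. *)
Lemma all_realized s : realized s.
Proof.
have f0 : face a b s [set: I].
  case: gp => gpA _ _; have [|u Hu] := gpA [set: I] b; first by rewrite cardsT.
  by exists u => i; rewrite inE /height Hu ?inE // subrr.
by apply/asboolP; apply: (face_perturb gp f0).
Qed.

Lemma few_valence s : valence s = #|I|.
Proof. by rewrite /valence; apply: eq_card => m; rewrite inE all_realized. Qed.

Lemma few_valence_total : (\sum_(s | realized s) valence s = 2 ^ #|I| * #|I|)%N.
Proof.
rewrite (eq_bigl predT) => [|s]; last by rewrite all_realized.
under eq_bigr do rewrite few_valence.
by rewrite sum_nat_const -[#|_|]/#|{ffun I -> bool}| card_ffun card_bool.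
Qed.

Lemma poincare_few : exists c,
  \sum_(s | realized s) (valence s)%:R * (phi s - c) ^+ 2 <= 192 * energy.
Proof.
pose s0 : {ffun I -> bool} := [ffun=> false]; exists (phi s0).
have E0 := energy_ge0 a b phi.
have H s : (phi s - phi s0) ^+ 2 <= 8 * energy.
  apply: le_trans (_ : 2 ^+ #|I| * energy <= _); last first.
    rewrite ler_wpM2r //; have -> : 8 = 2 ^+ 3 :> R by ring.
    by rewrite ler_eXn2l // ltr1n.
  have := @cube_le _ _ phi predT [set: I] (fun _ _ _ => erefl) s s0 isT.
  rewrite cardsT => H; apply: le_trans (H _) _; first by move=> i; rewrite inE.
  rewrite ler_wpM2l ?exprn_ge0 // exchange_big /=.
  apply: eqr_le; rewrite /energy; apply: eq_big => [s1|s1 _]; first by rewrite all_realized.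
  by apply: eq_bigl => t; rewrite inE all_realized.
apply: le_trans (_ : \sum_(s | realized s) 3 * (8 * energy) <= _).
  apply: ler_sum => s _; rewrite few_valence; apply: ler_pM => //.
  - by rewrite sqr_ge0.
  - by rewrite ler_nat.
rewrite sumr_const -[leLHS]mulr_natl.
have c8 : #|realized|%:R <= 8 :> R.
  rewrite ler_nat; apply: leq_trans (max_card _) _.
  by rewrite card_ffun card_bool -[8%N]/(2 ^ 3)%N leq_exp2l.
have := ler_wpM2r (mulr_ge0 (ler0n R 3) (mulr_ge0 (ler0n R 8) E0)) c8.
by move=> h; apply: le_trans h _; lra.
Qed.

End FewPlanes.

(** * From general position to equations *)

Local Open Scope classical_set_scope.
Local Open Scope ring_scope.

Section Equations.
Variable R : realType.

(** A nonzero column that annihilates a matrix of rank two has that matrix as its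
    kernel, up to row space. *)
Lemma hyperplane_equation (A : set 'rV[R]_3) : affine_subspace 2 A ->
  exists ab : 'cV[R]_3 * R, A = [set x | (x *m ab.1) 0 0 = ab.2].
Proof.
move=> [p [U [rU ->]]].
have c0 : cokermx U != 0 by rewrite -mxrank_eq0 mxrank_coker rU.
have [j cj] : exists j, col j (cokermx U) != 0.
  apply/existsP; apply: contraNT c0 => /existsPn H; apply/eqP/matrixP => i j.
  by have /negPn/eqP/colP/(_ i) := H j; rewrite !mxE.
set v := col j (cokermx U) in cj.
have Uv : U *m v = 0 by rewrite /v colE mulmxA mulmx_coker mul0mx.
have E : (U :=: kermx v)%MS.
  apply/eqmxP; rewrite -mxrank_leqif_eq; last by apply/sub_kermxP.
  rewrite mxrank_ker rU.
  suff -> : \rank v = 1%N by [].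
  by apply/eqP; rewrite eqn_leq rank_leq_col lt0n mxrank_eq0.
exists (v, (p *m v) 0 0); apply/seteqP; split => x /=.
  rewrite E => /sub_kermxP /matrixP /(_ 0 0); rewrite mulmxBl !mxE.
  by move/eqP; rewrite subr_eq0 => /eqP.
move=> H; rewrite E; apply/sub_kermxP/matrixP => i k.
by rewrite mulmxBl [LHS]mxE [in X in _ + X]mxE !ord1 H subrr mxE.
Qed.

(** Differences of points of the smaller subspace are directions of the larger
    one. *)
Lemma affine_subspace_le (k l : nat) (A B : set 'rV[R]_3) : affine_subspace k A ->
  affine_subspace l B -> A `<=` B -> (k <= l)%N.
Proof.
move=> [p [U [<- ->]]] [q [W [<- ->]]] AB; apply: mxrankS.
have pW : (p - q <= W)%MS by apply: AB => /=; rewrite subrr sub0mx.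
apply/row_subP => i.
have : (p + row i U - q <= W)%MS.
  by apply: AB => /=; rewrite addrAC subrr add0r row_sub.
move=> h; have -> : row i U = (p + row i U - q) - (p - q) by rewrite opprB addrA subrK addrAC subrr add0r.
by rewrite addmx_sub ?eqmx_opp.
Qed.

Variables (I : finType) (a : I -> 'cV[R]_3) (b : I -> R).
Variable K : {set I}.

Definition zeros : set 'rV[R]_3 := [set x | forall i, i \in K -> height a b i x = 0].

Definition normals : 'M[R]_(3, #|K|) := \matrix_(r, c) a (enum_val c) r 0.

Lemma mul_normals u c : (u *m normals) 0 c = dot a (enum_val c) u.
Proof. by rewrite /dot !mxE; apply: eq_bigr => r _; rewrite mxE. Qed.

Lemma normals_ker u : u *m normals = 0 <-> (forall i, i \in K -> dot a i u = 0).
Proof.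
split => [H i iK|H].
  by rewrite -(enum_rankK_in iK iK) -mul_normals H mxE.
apply/rowP => c; rewrite mul_normals mxE H //; exact: enum_valP.
Qed.

(** The directions of the intersection are the kernel of the matrix of normals,
    whose dimension is prescribed. *)
Lemma zeros_rank : affine_subspace (3 - #|K|) zeros -> (#|K| <= 3)%N ->
  \rank normals = #|K|.
Proof.
move=> [p [U [rU E]]] K3.
have zp : zeros p by rewrite E /= subrr sub0mx.
have EU (u : 'rV[R]_3) : (u <= U)%MS = (u *m normals == 0).
  apply/idP/eqP => [uU|/(proj1 (normals_ker _)) H].
    apply: (proj2 (normals_ker _)) => i iK.
    have : zeros (p + u) by rewrite E /= addrAC subrr add0r.
    by move=> /(_ i iK); rewrite heightD zp // add0r.
  have : zeros (p + u) by move=> i iK; rewrite heightD zp // H // addr0.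
  by rewrite E /= addrAC subrr add0r.
have EK : (U :=: kermx normals)%MS.
  apply/eqmxP/andP; split; apply/row_subP => i.
    by apply/sub_kermxP/eqP; rewrite -EU row_sub.
  by rewrite EU -row_mul mulmx_ker linear0.
have := mxrank_ker normals; rewrite -EK rU.
by have := rank_leq_row normals; lia.
Qed.

End Equations.

Lemma generic_of_position (R : realType) (H : {fset set 'rV[R]_3})
    (a : H -> 'cV[R]_3) (b : H -> R) :
    (forall h : H, val h = [set x | (x *m a h) 0 0 = b h]) ->
  general_position H -> generic_planes a b.
Proof.
move=> Hab gp.
have inter (K : {set H}) : exists2 L : {fset set 'rV[R]_3}, (L `<=` H)%fset /\ #|` L| = #|K| &
    \bigcap_(h in [set` L]) h = zeros a b K.
  exists [fset (val i) | i in K]%fset; first split.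
  - by apply/fsubsetP => h /imfsetP[i _ ->]; exact: valP.
  - rewrite card_imfset /=; last exact: val_inj.
    by rewrite cardE.
  - apply/seteqP; split => x /= Hx.
      move=> i iK; have := Hx (val i); rewrite Hab /= => Hi.
      rewrite /height /dot Hi ?subrr //.
      by rewrite -Hab; apply/imfsetP; exists i.
    move=> h /= /imfsetP[i iK ->]; rewrite Hab /=.
    by have /eqP := Hx i iK; rewrite /height subr_eq0 => /eqP.
have rk (K : {set H}) : (#|K| <= 3)%N -> \rank (normals a K) = #|K|.
  move=> K3; apply: (zeros_rank (b := b)) => //.
  have [L [LH cL] <-] := inter K; rewrite -cL.
  by have [h _] := gp L LH; apply: h; rewrite cL.
split.
- move=> K r K3; have := rk K K3 => rK.
  pose v : 'rV[R]_#|K| := \row_c r (enum_val c).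
  have /submxP[u Eu] : (v <= normals a K)%MS by apply: submx_full; rewrite /row_full rK.
  exists u => i iK.
  by rewrite -{1}(enum_rankK_in iK iK) -mul_normals -Eu mxE enum_rankK_in.
- move=> K u K3 Hu; have rK : \rank (normals a K) = #|K| by apply: rk; rewrite K3.
  have : u *m normals a K = 0 by apply: (proj2 (normals_ker _ _ _)).
  move/sub_kermxP; have : \rank (kermx (normals a K)) = 0%N by rewrite mxrank_ker rK [X in (_ - X)%N]K3.
  by move/eqP; rewrite mxrank_eq0 => /eqP ->; rewrite submx0 => /eqP.
- move=> K x K4 Hx; have [L [LH cL] EL] := inter K.
  have [_ h] := gp L LH; have : zeros a b K x by [].
  by rewrite -EL h // cL K4.
Qed.

(** * Chambers are cells of sign vectors *)

Section Cells.
Variables (R : realType) (H : {fset set 'rV[R]_3}).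
Variables (a : H -> 'cV[R]_3) (b : H -> R).
Hypothesis Hab : forall h : H, val h = [set x | (x *m a h) 0 0 = b h].
Hypothesis arr : arrangement H.
Hypothesis pos : general_position H.

Local Notation height := (height a b).
Local Notation dot := (dot a).
Local Notation neg := (neg a b).
Local Notation realized := (realized a b).
Implicit Types (s : {ffun H -> bool}) (x z : 'rV[R]_3) (i : H).

Let gp : generic_planes a b := generic_of_position Hab pos.

Definition cell s : set 'rV[R]_3 := [set x | forall i, 0 < (-1) ^+ s i * height i x].
Definition closed_cell s : set 'rV[R]_3 :=
  [set x | forall i, 0 <= (-1) ^+ s i * height i x].
Definition signs x : {ffun H -> bool} := [ffun i => neg i x].

Lemma planeE i x : val i x <-> height i x = 0.
Proof.
rewrite Hab /height /dot /=; split => [->|/eqP]; first by rewrite subrr.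
by rewrite subr_eq0 => /eqP.
Qed.

Lemma complE x : arr_complement H x <-> forall i, height i x != 0.
Proof.
split => [Hx i|Hx [h hH hx]].
  by apply/eqP => /planeE ix; apply: Hx; exists (val i) => //=; exact: valP.
by have /eqP := Hx [` hH]%fset; apply; apply/planeE.
Qed.

Lemma realized_cell s : realized s <-> exists x, cell s x.
Proof.
split => [/asboolP[x Hx]|[x Hx]]; last first.
  by apply/asboolP; exists x => i; rewrite inE.
by exists x => i; have := Hx i; rewrite inE.
Qed.

Lemma cell_signs s x : cell s x -> s = signs x.
Proof.
move=> sx; apply/ffunP => i; rewrite ffunE; have := sx i.
by rewrite sign_gt0 => /andP[_ /eqP <-].
Qed.

Lemma signs_cell x : arr_complement H x -> cell (signs x) x.
Proof. by move/complE => Hx i; rewrite sign_gt0 Hx ffunE eqxx. Qed.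

Lemma cell_compl s x : cell s x -> arr_complement H x.
Proof.
by move=> sx; apply/complE => i; have := sx i; rewrite sign_gt0 => /andP[].
Qed.

Lemma dot_continuous i : continuous (dot i : 'rV[R]_3 -> R).
Proof.
have -> : (dot i : 'rV[R]_3 -> R) = (fun x : 'rV[R]_3 => x 0 0 * a i 0 0
   + x 0 1 * a i 1 0 + x 0 2%:R * a i 2%:R 0).
  apply/funext => x; rewrite /dot mxE !big_ord_recl big_ord0 addr0 addrA.
  by congr (_ + x _ _ * a i _ _ + x _ _ * a i _ _); apply: val_inj.
have C (j : 'I_3) : continuous (fun x : 'rV[R]_3 => x 0 j * a i j 0).
  move=> x; exact: (cvgM (@coord_continuous R 1 3 0 j x) (@cvg_cst _ _ _ (nbhs x) _)).
by move=> x; exact: (cvgD (cvgD (C 0 x) (C 1 x)) (C 2%:R x)).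
Qed.

Lemma height_continuous i : continuous (height i : 'rV[R]_3 -> R).
Proof.
have -> : (height i : 'rV[R]_3 -> R) = (fun x => dot i x - b i) by [].
by move=> x; exact: (cvgB (@dot_continuous i x) (@cvg_cst _ _ _ (nbhs x) _)).
Qed.

Lemma line_continuous x (v : 'rV[R]_3) : continuous (fun t : R => x + t *: v).
Proof.
move=> t; apply: cvgD; first exact: cvg_cst.
exact: scalel_continuous.
Qed.

Lemma height_line i x (v : 'rV[R]_3) t : height i (x + t *: v) = height i x + t * dot i v.
Proof. by rewrite heightD dotZ. Qed.

(** A cell is convex, hence connected; conversely the height over a plane cannot
    change its sign on a connected set that avoids this plane. *)
Lemma component_cell x : arr_complement H x ->
  connected_component (arr_complement H) x = cell (signs x).
Proof.
move=> Hx; have xs := signs_cell Hx; apply/seteqP; split => z.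
  move=> Cz i; set C := connected_component _ _ in Cz.
  have Cc : connected C by exact: component_connected.
  have Cx : C x by exact: connected_component_refl.
  have imc : connected (height i @` C).
    apply: connected_continuous_connected => //.
    by apply: continuous_subspaceT; exact: height_continuous.
  move/connected_intervalP: imc => imc.
  have n0 : ~ (height i @` C) 0.
    move=> [w Cw w0]; have /complE/(_ i) : arr_complement H w.
      exact: connected_component_sub Cw.
    by rewrite w0 eqxx.
  have Hz : height i z != 0.
    by apply/eqP => z0; apply: n0; exists z.
  have Hxi := (complE x).1 Hx i.
  have fz : (height i @` C) (height i z) by exists z.
  have fx : (height i @` C) (height i x) by exists x.
  rewrite sign_gt0 Hz ffunE /neg /=; apply/eqP.
  case: (ltgtP (height i z) 0) Hz => // hz _; case: (ltgtP (height i x) 0) Hxi => // hx _.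
    by exfalso; apply: n0; apply: (imc _ _ fz fx); rewrite (ltW hz) (ltW hx).
  by exfalso; apply: n0; apply: (imc _ _ fx fz); rewrite (ltW hz) (ltW hx).
move=> zs; pose w (t : R) := x + t *: (z - x).
exists (w @` `[0, 1]%classic); last first.
  by exists 1 => /=; rewrite ?in_itv /= ?ler01 ?lexx // /w scale1r addrC subrK.
split.
- by exists 0 => /=; rewrite ?in_itv /= ?ler01 ?lexx // /w scale0r addr0.
- move=> _ [t /= t01 <-]; apply: (@cell_compl (signs x)) => i.
  rewrite height_line (dotB_height a b); move: t01; rewrite in_itv /= => /andP[t0 t1].
  have := xs i; have := zs i.
  move: ((-1) ^+ signs x i) (height i x) (height i z) => e p q hq hp.
  have -> : e * (p + t * (q - p)) = (1 - t) * (e * p) + t * (e * q) by ring.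
  case: (ltgtP t 1) t1 => // [t1 _|-> _]; last by rewrite subrr mul0r add0r mul1r.
  by apply: ltr_pwDl; [rewrite mulr_gt0 ?subr_gt0|rewrite mulr_ge0 ?(ltW hq)].
- apply: connected_continuous_connected; first exact: segment_connected.
  by apply: continuous_subspaceT; exact: line_continuous.
Qed.

Lemma chambersE C : chambers H C <-> exists2 s, realized s & C = cell s.
Proof.
split=> [[x Hx <-]|[s /realized_cell[x sx] ->]].
  exists (signs x); last exact: component_cell.
  by apply/realized_cell; exists x; exact: signs_cell.
exists x; first exact: (cell_compl sx).
by rewrite component_cell ?(cell_signs sx) //; exact: cell_compl sx.
Qed.

Lemma chambers_finite : finite_set (chambers H).
Proof.
apply: (@sub_finite_set _ _ (cell @` [set: {ffun H -> bool}])).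
  by move=> C /chambersE[s _ ->]; exists s.
by apply: finite_image; exact: finite_finset.
Qed.

(** A point satisfying the weak inequalities is the limit of points on the segment
    towards an interior point. *)
Lemma cell_closure s : realized s -> closure (cell s) = closed_cell s.
Proof.
move=> /realized_cell[x sx]; apply/seteqP; split => z.
  move=> cz i; pose A := [set y | 0 <= (-1) ^+ s i * height i y].
  have Acl : closed A.
    apply: (@preimage_closed _ _ (fun y => (-1) ^+ s i * height i y) [set r | 0 <= r]).
      by move=> y _; exact: (cvgM (@cvg_cst _ _ _ (nbhs y) _) (@height_continuous i y)).
    exact: closed_ge.
  have : closure A z by apply: closureS cz => y ys; exact: ltW.
  by move/closure_id: Acl => <-.
move=> zs B nB; pose w (t : R) := z + t *: (x - z).
have w0 : w @ (0 : R) --> z.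
  have := @line_continuous z (x - z) 0; rewrite /continuous_at /= scale0r addr0.
  by [].
have /nbhs_ballP[e e0 He] := w0 _ nB.
pose t := Num.min (e / 2) 1.
have t0 : 0 < t by rewrite lt_min divr_gt0 //= ltr01.
have t1 : t <= 1 by rewrite ge_min lexx orbT.
exists (w t); split; last first.
  apply: He; rewrite /ball /= sub0r normrN gtr0_norm //.
  apply: (@le_lt_trans _ _ (e / 2)); first by rewrite ge_min lexx.
  by rewrite ltr_pdivrMr // ltr_pMr // ltr1n.
move=> i; rewrite height_line (dotB_height a b).
have := sx i; have := zs i.
move: ((-1) ^+ s i) (height i x) (height i z) => c p q hq hp.
have -> : c * (q + t * (p - q)) = (1 - t) * (c * q) + t * (c * p) by ring.
by apply: ltr_wpDl; [rewrite mulr_ge0 ?subr_ge0|rewrite mulr_gt0].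
Qed.

Lemma plane_affine i : affine_subspace 2 (val i).
Proof. by have := arr (valP i). Qed.

Lemma planes_affine i j : i != j -> affine_subspace 1 (val i `&` val j).
Proof.
move=> ij; pose K := [fset val i; val j]%fset.
have KH : (K `<=` H)%fset.
  by apply/fsubsetP => h; rewrite !inE => /orP[/eqP->|/eqP->]; exact: valP.
have K2 : #|` K| = 2%N by rewrite cardfs2 (inj_eq val_inj) ij.
have [h _] := pos KH; rewrite K2 in h.
suff <- : \bigcap_(h in [set` K]) h = val i `&` val j by exact: h.
apply/seteqP; split => x /=.
  by move=> Kx; split; apply: Kx; rewrite /= !inE eqxx ?orbT.
by move=> [ix jx] g /=; rewrite !inE => /orP[/eqP->|/eqP->].
Qed.

Lemma sub_hull (F A : set 'rV[R]_3) k : affine_subspace k A -> F `<=` A ->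
  affine_hull F `<=` A.
Proof. by move=> Ak FA x Fx; exact: (Fx k A). Qed.

(** Around a relative interior point the wall contains a small disc of the plane,
    and two points of a line determine the line. *)
Lemma wall_hull s m : realized s -> realized (flip s m) ->
  affine_hull (closure (cell s) `&` val m) = val m.
Proof.
move=> rs rm; rewrite cell_closure //; apply/seteqP; split.
  by apply: (sub_hull (plane_affine m)) => x [_ xm].
have [x0 Hx0] := face_mid (asboolP _ rs) (asboolP _ rm).
have mx0 : height m x0 = 0 by have := Hx0 m; rewrite !inE eqxx.
have ix0 i : i != m -> 0 < (-1) ^+ s i * height i x0.
  by move=> im; have := Hx0 i; rewrite !inE (negbTE im).
move=> z /planeE zm k A [p [U [_ ->]]] FA.
have [|c c0 Hc] := @small_step _ _ (fun i => i != m)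
   (fun i => (-1) ^+ s i * height i x0) (fun i => (-1) ^+ s i * dot i (z - x0)).
  exact: ix0.
have F0 : (x0 - p <= U)%MS.
  apply: FA; split; last exact/planeE.
  move=> i; case: (eqVneq i m) => [->|im]; first by rewrite mx0 mulr0.
  by rewrite ltW ?ix0.
have F1 : (x0 + c *: (z - x0) - p <= U)%MS.
  apply: FA; split; last first.
    by apply/planeE; rewrite height_line (dotB_height a b) zm mx0 subrr mulr0 addr0.
  move=> i; rewrite height_line; case: (eqVneq i m) => [->|im].
    by rewrite (dotB_height a b) zm mx0 subrr mulr0 addr0 mulr0.
  by rewrite mulrDr mulrCA ltW ?Hc.
have : (c *: (z - x0) <= U)%MS.
  have -> : c *: (z - x0) = (x0 + c *: (z - x0) - p) - (x0 - p).
    by rewrite opprB addrA subrK addrAC subrr add0r.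
  by rewrite addmx_sub // eqmx_opp.
rewrite eqmx_scale ?gt_eqF // => h /=.
have -> : z - p = (z - x0) + (x0 - p) by rewrite addrA subrK.
exact: addmx_sub.
Qed.

Lemma closed_cell_wall s m x : height m x = 0 ->
  closed_cell (flip s m) x <-> closed_cell s x.
Proof.
move=> mx; split => Hx i; have := Hx i; rewrite ?ffunE.
all: by case: (eqVneq i m) => [->|im]; rewrite ?addbF // mx !mulr0.
Qed.

Definition sign_of (v : chamber_type H) : {ffun H -> bool} :=
  xget [ffun=> false] [set s | realized s /\ val v = cell s].

Lemma sign_ofP v : realized (sign_of v) /\ val v = cell (sign_of v).
Proof.
apply: (@xgetPex _ _ [set s | realized s /\ val v = cell s]).
have : val v \in fset_set (chambers H) by exact: valP.
rewrite in_fset_set; last exact: chambers_finite.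
by rewrite inE => /chambersE[s rs ->]; exists s.
Qed.

Lemma sign_of_realized v : realized (sign_of v).
Proof. by case: (sign_ofP v). Qed.

Lemma sign_of_inj : injective sign_of.
Proof. by move=> u v E; apply: val_inj; rewrite (sign_ofP u).2 (sign_ofP v).2 E. Qed.

Lemma sign_of_surj s : realized s -> exists v, sign_of v = s.
Proof.
move=> rs; have Cs : cell s \in fset_set (chambers H).
  by rewrite in_fset_set ?inE; [apply/chambersE; exists s|exact: chambers_finite].
exists [` Cs]%fset; have [_ /= E] := sign_ofP [` Cs]%fset.
have /realized_cell[x sx] := rs.
have sx' : cell (sign_of [` Cs]%fset) x by rewrite -E.
exact: etrans (cell_signs sx') (esym (cell_signs sx)).
Qed.

(** A common facet lies in every plane that separates the two chambers; two such
    planes would confine a two-dimensional set to a line. *)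
Lemma adjacentE u v :
  chamber_adj H u v <-> exists m, sign_of v = flip (sign_of u) m.
Proof.
have [ru Eu] := sign_ofP u; have [rv Ev] := sign_ofP v.
set s := sign_of u in ru Eu *; set s' := sign_of v in rv Ev *.
split => [/asboolP[uv [F [Fd [h hH Fu]] [_ [h' h'H Fv]]]]|[m E]].
  have Fi i : s i != s' i -> F `<=` val i.
    move=> si x Fx; apply/planeE.
    have xu : closed_cell s x.
      by rewrite -cell_closure // -Eu; move: Fx; rewrite Fu => -[].
    have xv : closed_cell s' x.
      by rewrite -cell_closure // -Ev; move: Fx; rewrite Fv => -[].
    apply/eqP; rewrite eq_le; move: (xu i) (xv i) si.
    by case: (s i); case: (s' i); rewrite //= ?expr1 ?expr0 ?mulN1r ?mul1r ?oppr_ge0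
      => -> ->.
  have [m sm] : exists m, s m != s' m.
    apply/existsP; apply: contrapT => /negP; rewrite negb_exists => /forallP Hs.
    apply: uv; apply: val_inj; rewrite Eu Ev; congr cell; apply/ffunP => i.
    by have := Hs i; rewrite negbK => /eqP.
  exists m; apply/ffunP => i; rewrite ffunE; case: (eqVneq i m) => [->|im].
    by rewrite addbT; move: sm; case: (s m); case: (s' m).
  rewrite addbF; apply/eqP; apply: contraT => si; rewrite eq_sym in si.
  suff sub : affine_hull F `<=` val i `&` val m.
    by have := affine_subspace_le Fd (planes_affine im) sub.
  apply: (sub_hull (planes_affine im)) => x Fx.
  by split; [exact: (Fi i si)|exact: (Fi m sm)].
apply/asboolP; split.
  by move=> uv; move: E; rewrite /s' -uv -/s => E; have := flip_neq s m; rewrite -E eqxx.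
have rm : realized (flip s m) by rewrite -E.
exists (closure (cell s) `&` val m).
  split; last by exists (val m); [exact: valP|rewrite Eu].
  by rewrite /has_dim wall_hull //; exact: plane_affine.
split.
  by rewrite /has_dim wall_hull //; exact: plane_affine.
exists (val m); first exact: valP.
rewrite Ev E !cell_closure //; apply/seteqP.
split => x [xc /planeE xm]; (split; last exact/planeE).
  exact: (closed_cell_wall _ xm).2.
exact: (closed_cell_wall _ xm).1.
Qed.

End Cells.

(** * The chamber graph *)

Section Transfer.
Variables (R : realType) (H : {fset set 'rV[R]_3}).
Variables (a : H -> 'cV[R]_3) (b : H -> R).
Hypothesis Hab : forall h : H, val h = [set x | (x *m a h) 0 0 = b h].
Hypothesis arr : arrangement H.
Hypothesis pos : general_position H.

Local Notation realized := (realized a b).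
Local Notation valence := (valence a b).
Local Notation sgn := (@sign_of R H a b).
Local Notation e := (chamber_adj H).

Let gp : generic_planes a b := generic_of_position Hab pos.

Lemma sum_chambers (G : {ffun H -> bool} -> R) :
  \sum_v G (sgn v) = \sum_(s | realized s) G s.
Proof.
transitivity (\sum_(s in [set sgn v | v in predT]%SET) G s).
  by rewrite big_imset //= => u v _ _; apply: (sign_of_inj Hab).
apply: eq_bigl => s; apply/imsetP/idP => [[v _ ->]|rs].
  exact: (sign_of_realized Hab).
by have [v <-] := sign_of_surj Hab rs; exists v.
Qed.

Lemma neighbours u :
  [set sgn v | v in [set v | e u v]]%SET =
  [set flip (sgn u) m | m in [set m | realized (flip (sgn u) m)]]%SET.
Proof.
apply/setP => s; apply/imsetP/imsetP => -[].
  move=> v; rewrite inE => /(adjacentE Hab arr pos)[m vm] ->.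
  by exists m => //; rewrite inE -vm; exact: (sign_of_realized Hab).
move=> m; rewrite inE => rm ->; have [v Ev] := sign_of_surj Hab rm.
exists v => //; rewrite inE; apply/(adjacentE Hab arr pos).
by exists m.
Qed.

Lemma sum_neighbours u (G : {ffun H -> bool} -> R) :
  \sum_(v | e u v) G (sgn v) =
  \sum_(m | realized (flip (sgn u) m)) G (flip (sgn u) m).
Proof.
transitivity (\sum_(s in [set sgn v | v in [set v | e u v]]%SET) G s).
  rewrite big_imset /=; last by move=> v w _ _; apply: (sign_of_inj Hab).
  by apply: eq_bigl => v; rewrite inE.
rewrite neighbours big_imset /=; last by move=> v w _ _; apply: flip_inj.
by apply: eq_bigl => v; rewrite inE.
Qed.

Lemma degree_valence u : degree e u = valence (sgn u).
Proof.
have := congr1 (fun A : {set {ffun H -> bool}} => #|A|) (neighbours u).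
rewrite card_imset; last exact: (sign_of_inj Hab).
by rewrite card_imset; last exact: flip_inj.
Qed.

Lemma chamber_adj_sym : symmetric e.
Proof.
have S u v : e u v -> e v u.
  move=> /(adjacentE Hab arr pos)[m E]; apply/(adjacentE Hab arr pos).
  by exists m; rewrite E flipK.
by move=> u v; apply/idP/idP; exact: S.
Qed.

Lemma chamber_adj_irr : irreflexive e.
Proof. by move=> u; apply/negP => /asboolP[]. Qed.

Hypothesis n1 : (1 <= #|{: H}|)%N.

(** A chamber has a face of the smallest dimension; crossing any plane through that
    face leads to a neighbour. *)
Lemma degree_gt0 u : (0 < degree e u)%N.
Proof.
rewrite degree_valence; have /asboolP fu := sign_of_realized Hab u.
have [T [_ fT cT]] := face_full gp fu.
have /card_gt0P[m mT] : (0 < #|T|)%N by rewrite cT leq_min.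
apply/card_gt0P; exists m; rewrite inE; apply/asboolP.
apply: (face_perturb gp fT) => i iT; rewrite ffunE.
have -> : (i == m) = false by apply: contraNF iT => /eqP ->.
by rewrite addbF.
Qed.

Lemma some_chamber : inhabited (chamber_type H).
Proof.
pose T := [set i | height a b i 0 == 0]%SET.
have f0 : face a b (signs a b 0) T.
  exists 0 => i; rewrite inE; case: eqP => // /eqP h.
  by rewrite sign_gt0 h ffunE eqxx.
have r0 : realized (signs a b 0) by apply/asboolP; apply: (face_perturb gp f0).
by have [v _] := sign_of_surj Hab r0; exact: inhabits v.
Qed.

(** Functions on chambers are extended by zero to the sign vectors that are not
    realized. *)
Definition on_signs (f : chamber_type H -> R) (s : {ffun H -> bool}) : R :=
  if [pick v | sgn v == s] is Some v then f v else 0.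

Lemma on_signsE f v : on_signs f (sgn v) = f v.
Proof.
rewrite /on_signs; case: pickP => [w /eqP E|/(_ v)]; last by rewrite eqxx.
by congr f; apply: (sign_of_inj Hab).
Qed.

Lemma dirichlet_energy f : dirichlet e f = energy a b (on_signs f).
Proof.
rewrite /dirichlet /energy -sum_chambers; apply: eq_bigr => u _.
transitivity (\sum_(v | e u v) (on_signs f (sgn u) - on_signs f (sgn v)) ^+ 2).
  by apply: eq_bigr => v _; rewrite !on_signsE.
rewrite (sum_neighbours u (fun s => (on_signs f (sgn u) - on_signs f s) ^+ 2)).
by apply: eq_bigr => m _; rewrite /jump real_normK ?num_real.
Qed.

Local Notation n := (#|{: H}|%:R : R).
Lemma chamber_poincare (C : R) : 192 <= C -> 6 * (64 + 8 * (48 * 432 * 12)) <= C ->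
  forall f : chamber_type H -> R, exists c,
  \sum_u (degree e u)%:R * (f u - c) ^+ 2 <= C * n ^+ 2 * dirichlet e f.
Proof.
move=> C_few C_many f.
have n0 : 1 <= n ^+ 2 by rewrite exprn_ege1 // ler1n.
have E0 := energy_ge0 a b (on_signs f).
suff [c Hc] : exists c, \sum_(s | realized s) (valence s)%:R * (on_signs f s - c) ^+ 2 <=
    C * n ^+ 2 * energy a b (on_signs f).
  exists c; rewrite dirichlet_energy; apply: le_trans Hc.
  rewrite -(sum_chambers (fun s => (valence s)%:R * (on_signs f s - c) ^+ 2)).
  by apply: ler_sum => v _; rewrite on_signsE degree_valence.
case: (leqP 4 #|{: H}|) => n4.
  have [c Hc] := poincare_many gp (on_signs f) n4; exists c; apply: le_trans Hc _.
  by rewrite ler_wpM2r // ler_wpM2r // exprn_ge0 ?ler0n.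
have [c Hc] := poincare_few gp n4 (on_signs f); exists c; apply: le_trans Hc _.
by rewrite ler_wpM2r // (le_trans C_few) // ler_peMr // (le_trans _ C_few).
Qed.

Lemma degree_sum_le : \sum_u (degree e u)%:R <= 4 * n ^+ 3 :> R.
Proof.
under eq_bigr do rewrite degree_valence.
rewrite (sum_chambers (fun s => (valence s)%:R)) -natr_sum.
case: (leqP 4 #|{: H}|) => n4; first exact: (valence_total gp).
rewrite (few_valence_total gp n4) -natrX -natrM ler_nat.
by move: #|{: H}| n4 n1 => [|[|[|[|k]]]].
Qed.

Lemma degree_sum_one : #|{: H}| = 1%N -> \sum_u (degree e u)%:R = 2 :> R.
Proof.
move=> n1'; under eq_bigr do rewrite degree_valence.
rewrite (sum_chambers (fun s => (valence s)%:R)) -natr_sum.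
by rewrite (few_valence_total gp) n1'.
Qed.

End Transfer.

Section Numerics.
Variable R : realType.

Lemma ln2_gt0 : 0 < ln 2 :> R.
Proof. by rewrite ln_gt0 // ltr1n. Qed.

(** With [t] about [12 C n^2 ln (n / eps)], the exponential is at most
    [(eps / n) ^ 3], which absorbs [M / 4 <= n ^ 3].  Rounding [t] up costs one
    step, which is paid for as long as [ln (n / eps)] stays away from zero.  This
    fails only for one plane and [eps] close to one, where the walk is within [eps]
    of stationarity at time zero. *)
Lemma mixing_steps (n eps C M : R) : 1 <= n -> 0 < eps -> eps < 1 -> 0 < C ->
    0 <= M -> M <= 4 * n ^+ 3 -> (n < 2 -> n = 1 /\ M = 2) ->
  exists2 t : nat,
    expR (- (t%:R / (4 * (C * n ^+ 2)))) * (M / 4) <= eps ^+ 2 &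
    t%:R <= (12 * C + 2 / ln 2) * (n ^+ 2 * ln (n / eps)).
Proof.
move=> n1 e0 e1 C0 M0 M4 small.
have n0 : 0 < n by lra.
have K0 : 0 < C * n ^+ 2 by rewrite mulr_gt0 // exprn_gt0.
have ne0 : 0 < n / eps by rewrite divr_gt0.
have ne1 : 1 < n / eps by rewrite ltr_pdivlMr // mul1r; lra.
have L0 : 0 < ln (n / eps) by rewrite ln_gt0.
have l2 := ln2_gt0.
case: (boolP ((n < 2) && (2^-1 <= eps ^+ 2))) => [/andP[n2 e2]|big].
  exists 0%N; last first.
    by rewrite mulr_ge0 // ?mulr_ge0 ?addr_ge0 ?divr_ge0 ?exprn_ge0 ?(ltW l2) ?(ltW L0) ?(ltW n0) //
      mulr_ge0 ?(ltW C0).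
  have [_ ->] := small n2; rewrite mul0r oppr0 expR0 mul1r; lra.
have L2 : ln 2 <= 2 * ln (n / eps).
  rewrite -[2 in X in _ <= X]/(2%:R) mulr_natl -lnXn // ler_ln ?posrE ?exprn_gt0 //.
  rewrite expr_div_n ler_pdivlMr ?exprn_gt0 //.
  move: big; rewrite negb_and -leNgt -ltNge => /orP[n2|e2].
    have : 2 ^+ 2 <= n ^+ 2 by rewrite ler_pXn2r // nnegrE; lra.
    have : eps ^+ 2 < 1 by rewrite exprn_ilt1 // ltW.
    by move: (eps ^+ 2) (n ^+ 2) => x y; rewrite expr2; lra.
  have : 1 <= n ^+ 2 by rewrite exprn_ege1.
  by move: (eps ^+ 2) (n ^+ 2) e2 => x y; lra.
pose x := 12 * (C * n ^+ 2) * ln (n / eps).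
have x0 : 0 <= x by rewrite mulr_ge0 ?mulr_ge0 // ltW.
exists (Num.truncn x).+1.
  have /andP[_ xt] := truncn_itv x0.
  have H1 : - ((Num.truncn x).+1%:R / (4 * (C * n ^+ 2))) <= - (3 * ln (n / eps)).
    rewrite lerN2 ler_pdivlMr ?mulr_gt0 //; apply: le_trans (ltW xt).
    by rewrite /x; apply: eqr_le; ring.
  have H2 : expR (- (3 * ln (n / eps))) = (eps / n) ^+ 3.
    rewrite expRN expRM_natl lnK ?posrE // -exprVn invf_div //.
  apply: (@le_trans _ _ ((eps / n) ^+ 3 * n ^+ 3)).
    apply: ler_pM; rewrite ?expR_ge0 //.
    - by rewrite divr_ge0.
    - by rewrite -H2 ler_expR.
    - lra.
  rewrite -exprMn divfK ?gt_eqF //.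
  by rewrite exprS ler_piMl ?exprn_ge0 ?ltW.
have /andP[tx _] := truncn_itv x0.
rewrite -natr1 mulrDl; apply: lerD; first by apply: le_trans tx _; apply: eqr_le; rewrite /x; ring.
have : 1 <= 2 / ln 2 * ln (n / eps).
  by rewrite mulrAC ler_pdivlMr // mul1r.
have : 1 <= n ^+ 2 by rewrite exprn_ege1.
rewrite mulrCA; move: (2 / ln 2 * _) (n ^+ 2) => p q h1 h2.
by apply: mulr_ege1.
Qed.

End Numerics.


Unset Implicit Arguments.

Theorem corollary4p11 (R : realType) :
  exists2 c : R, 0 < c &
    forall (H : {fset set 'rV[R]_3}) (eps : R),
      arrangement H -> general_position H -> (1 <= #|` H|)%N ->
      0 < eps -> eps < 1 ->
      exists2 t : nat, is_mixing_time (chamber_adj H) eps t &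
        t%:R <= c * (#|` H|%:R ^+ 2 * ln (#|` H|%:R / eps)).
Proof.
have [C C_few C_many] : exists2 C : R, 192 <= C & 6 * (64 + 8 * (48 * 432 * 12)) <= C.
  by exists (6 * (64 + 8 * (48 * 432 * 12))); lra.
have C0 : 0 < C by apply: lt_le_trans C_few.
exists (12 * C + 2 / ln 2).
  by rewrite addr_gt0 ?divr_gt0 ?mulr_gt0 ?ln2_gt0.
move=> H eps arr pos; rewrite cardfE => n1 e0 e1.
have [ab Hab] := choice (fun h : H => hyperplane_equation (arr _ (valP h))).
pose a h := (ab h).1; pose b h := (ab h).2.
have {}Hab (h : H) : val h = [set x | (x *m a h) 0 0 = b h] by exact: Hab.
have [v0] := some_chamber Hab pos.
set n : R := #|{: H}|%:R.
have n1R : 1 <= n by rewrite ler1n.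
have small : n < 2 -> n = 1 /\ \sum_u (degree (chamber_adj H) u)%:R = 2 :> R.
  rewrite ltr_nat => n2; have n1' : #|{: H}| = 1%N by apply/eqP; rewrite eqn_leq n1 andbT.
  by split; [rewrite /n n1'|exact: (degree_sum_one Hab arr pos)].
have M0 : 0 <= \sum_u (degree (chamber_adj H) u)%:R :> R by apply: sumr_ge0.
have [t0 Ht0 t0le] := mixing_steps n1R e0 e1 C0 M0 (degree_sum_le Hab arr pos n1) small.
have K0 : 0 < C * n ^+ 2 by rewrite mulr_gt0 // exprn_gt0; lra.
have mix : mixing_dist (chamber_adj H) t0 <= eps.
  exact: (mixing_dist_le (chamber_adj_sym Hab arr pos) (@chamber_adj_irr _ H)
    (degree_gt0 Hab arr pos n1) K0 (chamber_poincare Hab arr pos n1 C_few C_many) v0).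
have ex : exists t, mixing_dist (chamber_adj H) t <= eps by exists t0.
exists (ex_minn ex); case: ex_minnP => t Ht tmin; first by split.
by apply: le_trans t0le; rewrite ler_nat tmin.
Qed.
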